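(* Let $L>0$ and $r\in(0,1)$, and for each integer $M\ge 1$ let the actuator centers be $$c_j^M:=\frac{(2j-1)L}{2M},\qquad j\in\{1,2,\dots,M\}.$$ Let $\omega_j^M:=\big(c_j^M-\tfrac{rL}{2M},c_j^M+\tfrac{rL}{2M}\big)$, let $U(c^M):=\operatorname{span}\{1_{\omega_j^M}\mid 1\le j\le M\}$, and let $E_M\subset L^2(0,L)$ be the linear span of the first $M$ Dirichlet eigenfunctions of $-\Delta$ on $(0,L)$. Then the oblique projection $P_{U(c^M)}^{E_M^\perp}:L^2(0,L)\to L^2(0,L)$ is well defined and its operator norm is $$\Big\|P_{U(c^M)}^{E_M^\perp}\Big\|=\left(\frac{4M^2}{r\pi^2(M-1)^2}\sin^2\left(\frac{(M-1)r\pi}{2M}\right)\right)^{-\frac12}\qquad\text{for } M\ge 2.$$ In particular, the sequence $\big\{\|P_{U(c^M)}^{E_M^\perp}\|\big\}_{M\ge 2}$ increases and converges to $\dfrac{\sqrt r\,\pi}{2\sin\left(\frac{r\pi}{2}\right)}$.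
   Context: $1_\omega$ is the indicator function of $\omega$. The Dirichlet eigenfunctions of $-\Delta=-\frac{d^2}{dx^2}$ on $(0,L)$ are ordered by increasing eigenvalue; the $i$-th one is a multiple of $\sin(i\pi x/L)$, $i\ge1$. $E_M^\perp$ is the orthogonal complement of $E_M$ in $L^2(0,L)$. $\|\cdot\|$ is the operator norm in $\mathcal L(L^2(0,L))$. Oblique projection: if a Hilbert space $H$ is a direct sum $H=F\oplus E$ of closed subspaces, $P_F^E:H\to F$ is the projection onto $F$ along $E$, i.e. $P_F^Ex=x_F$ where $x=x_F+x_E$ is the unique decomposition with $(x_F,x_E)\in F\times E$. The projection is well defined exactly when the direct sum holds. *)

(* Defs.v *)
From HB Require Import structures.
From mathcomp Require Import all_boot all_order all_algebra.
From mathcomp Require Import all_classical all_reals all_analysis.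
From mathcomp Require Import measurable_realfun ess_sup_inf ring lra.
Set Implicit Arguments.
Unset Strict Implicit.
Unset Printing Implicit Defensive.
Import Order.TTheory GRing.Theory Num.Theory.
Import numFieldNormedType.Exports.
Local Open Scope classical_set_scope.
Local Open Scope quotient_scope.
Local Open Scope ring_scope.

(* The library's [LspaceType mu p1] is the set of classes modulo a.e. equality
   of p-integrable functions; it comes without any algebraic structure. *)
Section Lspace_normedModType.
Context d (T : measurableType d) (R : realType).
Variables (mu : {measure set T -> \bar R}) (p : \bar R) (p1 : (1 <= p)%E).
Local Notation Lfun := (LfunType mu p1).
Local Notation Lspace := (LspaceType mu p1).

Lemma Lnorm_ae_eq (f g : T -> R) : measurable_fun setT f ->
  measurable_fun setT g -> f = g %[ae mu] ->
  Lnorm mu p (EFin \o f) = Lnorm mu p (EFin \o g).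
Proof.
move=> mf mg fg; rewrite unlock /Lnorm.
case: p p1 => [q q1|_|//].
  have mpow (h : T -> R) : measurable_fun setT h ->
      measurable_fun setT (fun x => `|(EFin \o h) x| `^ q)%E.
    move=> mh; apply/measurable_EFinP => /=.
    apply: (@measurableT_comp _ _ _ _ _ _ (@powR R ^~ q)) => //.
    exact: measurableT_comp.
  congr (_ `^ _)%E; apply: ge0_ae_eq_integral => //.
  - exact: mpow.
  - exact: mpow.
  - by move=> x _; exact: poweR_ge0.
  - by move=> x _; exact: poweR_ge0.
  - by apply: filterS fg => x /= + Dx => ->.
case: ifPn => // _; apply: eq_ess_sup.
by apply: filterS fg => x /= ->.
Qed.

Definition mfun_of_Lfun (f : Lfun) : {mfun T >-> measurableTypeR R} :=
  MeasurableFun.Pack (MeasurableFun.Class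
    (isMeasurableFun.Build _ _ T (measurableTypeR R) (f : T -> R)
      (@measurable_funPT _ _ T R f))).

Definition mfun_class (f : Lfun) : {mfun_ mu, T >-> measurableTypeR R} :=
  \pi_({mfun_ mu, T >-> measurableTypeR R})%qT (mfun_of_Lfun f).

Lemma mfun_class_ae (f : Lfun) : (mfun_class f : T -> R) = f %[ae mu].
Proof.
have /eqP := reprK (mfun_class f).
by rewrite [X in _ == X]/mfun_class eqmodE => /asboolP.
Qed.

Lemma measurable_mfun_class (f : {mfun_ mu, T >-> measurableTypeR R}) :
  measurable_fun setT (f : T -> R).
Proof. exact: (@measurable_funPT _ _ T (measurableTypeR R) (repr f)). Qed.

Lemma Lspace_of_subproof (f : Lfun) : finite_norm mu p (mfun_class f).
Proof.
rewrite /finite_norm (Lnorm_ae_eq _ _ (mfun_class_ae f)).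
- exact: Lfunction_finite.
- exact: measurable_mfun_class.
- exact: measurable_funPT.
Qed.

Definition Lspace_of (f : Lfun) : Lspace := LebesgueSpace.Pack
  (LebesgueSpace.Class
    (isFinLebesgue.Build _ _ _ _ _ p1 _ (Lspace_of_subproof f))).

Lemma Lspace_ofE f : (Lspace_of f : T -> R) = f %[ae mu].
Proof. exact: mfun_class_ae. Qed.

Lemma Lspace_Lfun (f : Lspace) : (f : T -> R) \in hoelder.Lfun mu p.
Proof.
rewrite inE/=; apply/andP; split; rewrite inE/=.
  exact: measurable_mfun_class.
exact: Lebesgue_finite.
Qed.

Definition Lspace_repr (f : Lspace) : Lfun := Lfun_Sub p1 (Lspace_Lfun f).

Lemma Lspace_eqP (f g : Lspace) :
  (f : T -> R) = (g : T -> R) %[ae mu] <-> f = g.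
Proof.
split=> [fg|->]; last exact: ae_eq_refl.
case: f g fg => [f [[Pf]]] [g [[Pg]]] /= fg.
have efg : f = g.
  rewrite -[f]reprK -[g]reprK; apply/eqP; rewrite eqmodE; exact/asboolP.
by subst g; rewrite (Prop_irrelevance Pf Pg).
Qed.

Lemma Lspace_reprK f : Lspace_of (Lspace_repr f) = f.
Proof. exact/Lspace_eqP/Lspace_ofE. Qed.

Lemma eq_Lspace_of (f g : Lfun) :
  (f : T -> R) = (g : T -> R) %[ae mu] -> Lspace_of f = Lspace_of g.
Proof.
move=> fg; apply/Lspace_eqP; apply: ae_eq_trans (Lspace_ofE f) _.
by apply: ae_eq_trans fg _; exact/ae_eq_sym/Lspace_ofE.
Qed.

HB.instance Definition _ := gen_eqMixin Lspace.
HB.instance Definition _ := gen_choiceMixin Lspace.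

Definition Lspace_zero : Lspace := Lspace_of 0.
Definition Lspace_opp (f : Lspace) : Lspace := Lspace_of (- Lspace_repr f).
Definition Lspace_add (f g : Lspace) : Lspace :=
  Lspace_of (Lspace_repr f + Lspace_repr g).
Definition Lspace_scale (a : R) (f : Lspace) : Lspace :=
  Lspace_of (a *: Lspace_repr f).

Let addE (f g : Lfun) :
  Lspace_add (Lspace_of f) (Lspace_of g) = Lspace_of (f + g).
Proof.
apply: eq_Lspace_of; have ff := Lspace_ofE f; have gg := Lspace_ofE g.
by apply: filterS2 ff gg => x e1 e2 Dx; exact: congr2 (e1 Dx) (e2 Dx).
Qed.

Let oppE (f : Lfun) : Lspace_opp (Lspace_of f) = Lspace_of (- f).
Proof.
apply: eq_Lspace_of; have ff := Lspace_ofE f.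
by apply: filterS ff => x e Dx; exact: congr1 (e Dx).
Qed.

Let scaleE a (f : Lfun) : Lspace_scale a (Lspace_of f) = Lspace_of (a *: f).
Proof.
apply: eq_Lspace_of; have ff := Lspace_ofE f.
by apply: filterS ff => x e Dx; exact: congr1 (e Dx).
Qed.

Let addA : associative Lspace_add.
Proof.
by move=> f g h; rewrite -[f]Lspace_reprK -[g]Lspace_reprK -[h]Lspace_reprK
  !addE addrA.
Qed.

Let addC : commutative Lspace_add.
Proof. by move=> f g; congr Lspace_of; rewrite addrC. Qed.

Let add0 : left_id Lspace_zero Lspace_add.
Proof. by move=> f; rewrite -[f]Lspace_reprK addE add0r. Qed.

Let addN : left_inverse Lspace_zero Lspace_opp Lspace_add.
Proof. by move=> f; rewrite -[f]Lspace_reprK oppE addE addNr. Qed.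

HB.instance Definition _ := GRing.isZmodule.Build Lspace addA addC add0 addN.

Let scaleA a b f : Lspace_scale a (Lspace_scale b f) = Lspace_scale (a * b) f.
Proof. by rewrite -[f]Lspace_reprK !scaleE scalerA. Qed.

Let scale1 : left_id 1 Lspace_scale.
Proof. by move=> f; rewrite -[f]Lspace_reprK scaleE scale1r. Qed.

Let scaleDr : right_distributive Lspace_scale +%R.
Proof.
move=> a f g; rewrite -[f]Lspace_reprK -[g]Lspace_reprK.
by rewrite [_ + _]addE !scaleE scalerDr [RHS]addE.
Qed.

Let scaleDl f : {morph Lspace_scale^~ f : a b / a + b}.
Proof.
move=> a b; rewrite -[f]Lspace_reprK.
by rewrite !scaleE scalerDl [RHS]addE.
Qed.

HB.instance Definition _ :=
  GRing.Zmodule_isLmodule.Build R Lspace scaleA scale1 scaleDr scaleDl.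

Lemma Lspace0E : ((0 : Lspace) : T -> R) = cst 0 %[ae mu].
Proof. exact: Lspace_ofE. Qed.

Lemma LspaceDE (f g : Lspace) : (f + g : T -> R) = (f : T -> R) \+ g %[ae mu].
Proof. exact: Lspace_ofE. Qed.

Lemma LspaceNE (f : Lspace) : (- f : T -> R) = \- (f : T -> R) %[ae mu].
Proof. exact: Lspace_ofE. Qed.

Lemma LspaceZE a (f : Lspace) : (a *: f : T -> R) = a \*: (f : T -> R) %[ae mu].
Proof. exact: Lspace_ofE. Qed.

Definition Lspace_norm (f : Lspace) : R := fine (Lnorm mu p (EFin \o f)).

Let normE (f : Lfun) : Lspace_norm (Lspace_of f) = fine (Lnorm mu p (EFin \o f)).
Proof.
congr fine; apply: Lnorm_ae_eq (Lspace_ofE f).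
- exact: measurable_mfun_class.
- exact: measurable_funPT.
Qed.

Let ler_normD f g : Lspace_norm (f + g) <= Lspace_norm f + Lspace_norm g.
Proof. by rewrite [f + g]/(Lspace_of _) normE; exact: ler_LnormD. Qed.

Let normrZ a f : Lspace_norm (a *: f) = `|a| * Lspace_norm f.
Proof.
rewrite [a *: f]/(Lspace_of _) normE.
have /(congr1 fine) := LnormZ (Lspace_repr f) a.
by rewrite -(finite_norm_fine (Lspace_repr f)) -EFinM.
Qed.

Let normr0_eq0 f : Lspace_norm f = 0 -> f = 0.
Proof.
move=> /(@fine_Lnormr_eq0 _ _ _ _ _ p1 (Lspace_repr f)) f0.
apply/Lspace_eqP; apply: ae_eq_trans f0 _.
exact/ae_eq_sym/Lspace0E.
Qed.

HB.instance Definition _ :=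
  @Lmodule_isNormed.Build R Lspace Lspace_norm ler_normD normrZ normr0_eq0.

End Lspace_normedModType.

Section oblique_projection.
Context (R : realType) (V : normedModType R).
Implicit Types (F E : set V) (x : V).

Definition closed_subspace F :=
  [/\ closed F, F 0 & forall (a : R) x y, F x -> F y -> F (a *: x + y)].

Definition is_direct_sum F E := [/\ closed_subspace F, closed_subspace E &
  forall x, exists! yz : V * V, [/\ F yz.1, E yz.2 & x = yz.1 + yz.2]].

(* P_F^E; the value is only meaningful when [is_direct_sum F E]. *)
Definition oblique_proj F E x : V :=
  xget 0 [set y | F y /\ exists2 z, E z & x = y + z].

Definition op_norm (P : V -> V) : \bar R :=
  ereal_sup [set `|P x|%:E | x in [set x | `|x| <= 1]].

Lemma oblique_projP F E x : is_direct_sum F E ->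
  F (oblique_proj F E x) /\ E (x - oblique_proj F E x).
Proof.
move=> [_ _ /(_ x) [[y z] [[/= Fy Ez xyz] _]]].
have : [set y | F y /\ exists2 z, E z & x = y + z] (oblique_proj F E x).
  apply: (@xgetPex _ 0 [set y | F y /\ exists2 z, E z & x = y + z]).
  by exists y; split=> //; exists z.
by move=> [Fp [t Et xpt]]; split=> //; rewrite [X in X - _]xpt addrC addKr.
Qed.

End oblique_projection.

Section L2.
Context d (T : measurableType d) (R : realType).
Variable mu : {measure set T -> \bar R}.
Local Notation L2 := (LspaceType mu (lee1n 2)).

Definition L2_dot (f g : L2) : R := \int[mu]_x (f x * g x).

Definition orthocomp (A : set L2) : set L2 :=
  [set f | forall g, A g -> L2_dot f g = 0].

(* The span in L^2 of the classes of [u 1], ..., [u M]. *)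
Definition L2_span (u : nat -> T -> R) (M : nat) : set L2 :=
  [set f | exists a : nat -> R,
    (f : T -> R) = (fun x => \sum_(1 <= i < M.+1) a i * u i x) %[ae mu]].

End L2.

Section actuators_eigenfunctions.
Context (R : realType).
Implicit Types (L r l : R) (M j : nat).

(* Lebesgue measure on (0, L), seen as a measure on the line. *)
Definition lebesgue_on L : {measure set (measurableTypeR R) -> \bar R} :=
  mrestr (@lebesgue_measure R) (@measurable_itv R `]0, L[).

Definition actuator_center L M j : R := (2 * j%:R - 1) * L / (2 * M%:R).

Definition actuator_support L r M j : set R :=
  `]actuator_center L M j - r * L / (2 * M%:R),
    actuator_center L M j + r * L / (2 * M%:R)[%classic.

Definition actuator_span L r M : set (LspaceType (lebesgue_on L) (lee1n 2)) :=
  @L2_span _ (measurableTypeR R) R (lebesgue_on L)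
    (fun j => \1_(actuator_support L r M j)) M.

(* [f] is an eigenfunction of - d^2/dx^2 on (0, L), with eigenvalue [l], under
   homogeneous Dirichlet boundary conditions. *)
Definition dirichlet_eigenpair L l (f : R -> R) :=
  [/\ {within `[0, L]%classic, continuous f}, f 0 = 0 /\ f L = 0,
      exists2 x, x \in `]0, L[ & f x != 0 &
      {in `]0, L[, forall x, [/\ derivable f x 1, derivable (derive1 f) x 1 &
        - derive1 (derive1 f) x = l * f x]}].

(* [(lam i, e i)], i >= 1, lists the eigenpairs by increasing eigenvalue, each
   eigenfunction up to a scalar multiple; [lam 0] and [e 0] are junk. *)
Definition dirichlet_eigensystem L (lam : nat -> R) (e : nat -> R -> R) :=
  [/\ forall i, (1 <= i)%N -> dirichlet_eigenpair L (lam i) (e i),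
      forall i j, (1 <= i)%N -> (i < j)%N -> lam i < lam j &
      forall l f, dirichlet_eigenpair L l f -> exists i c,
        [/\ (1 <= i)%N, l = lam i & {in `[0, L], forall x, f x = c * e i x}]].

Definition eigen_span L (e : nat -> R -> R) M :
    set (LspaceType (lebesgue_on L) (lee1n 2)) :=
  @L2_span _ (measurableTypeR R) R (lebesgue_on L) e M.

End actuators_eigenfunctions.

Section dirichlet_eigenpairs.
Context (R : realType).
Implicit Types (L l : R).

Lemma cst_on_itv L (w : R -> R) :
  {in `]0, L[, forall x : R, is_derive x (1 : R) w 0} ->
  {in `]0, L[ &, forall x y, w x = w y}.
Proof.
move=> dw; have le0 x y : x \in `]0, L[ -> y \in `]0, L[ -> x <= y -> w x = w y.
  rewrite !in_itv/= => /andP[x0 xL] /andP[y0 yL] xy.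
  have [c _] : exists2 c, c \in `[x, y]%R & w y - w x = 0 * (y - x).
    apply: (@MVT_segment R w (fun=> 0)) => //.
      move=> z; rewrite in_itv/= => /andP[xz zy]; apply: dw.
      by rewrite in_itv/= (lt_trans x0 xz) (lt_trans zy yL).
    apply: derivable_within_continuous => z; rewrite in_itv/= => /andP[xz zy].
    have zi : z \in `]0, L[.
      by rewrite in_itv/= (lt_le_trans x0 xz) (le_lt_trans zy yL).
    by have [] := dw _ zi.
  by rewrite mul0r => /eqP; rewrite subr_eq0 => /eqP.
move=> x y xI yI; case: (leP x y) => [|/ltW] xy; first exact: le0.
by rewrite (le0 y x).
Qed.

Lemma dirichlet_fundamental L l (f C C' S S' : R -> R) : 0 < L ->
  dirichlet_eigenpair L l f ->
  (forall x : R, is_derive x (1 : R) C (C' x)) -> (forall x : R, is_derive x (1 : R) S (S' x)) ->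
  (forall x : R, is_derive x (1 : R) C' (- l * C x)) ->
  (forall x : R, is_derive x (1 : R) S' (- l * S x)) ->
  (forall x, C x * S' x - C' x * S x = 1) -> C 0 = 1 -> S 0 = 0 ->
  S L = 0 /\ exists b, {in `[0, L], forall x, f x = b * S x}.
Proof.
move=> L0 [cf [f0 fL] [x0 x0I fx0] df] dC dS dC' dS' W C0 S0.
have f'E x : x \in `]0, L[ -> is_derive x (1 : R) f (derive1 f x).
  by move=> /df[? _ _]; rewrite derive1E; apply: DeriveDef.
have f''E x : x \in `]0, L[ -> is_derive x (1 : R) (derive1 f) (- l * f x).
  move=> /df[_ ? e]; apply: DeriveDef => //.
  by rewrite -derive1E mulNr -e opprK.
pose A x := f x * S' x - derive1 f x * S x.
pose B x := derive1 f x * C x - f x * C' x.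
have dA : {in `]0, L[, forall x : R, is_derive x (1 : R) A 0}.
  move=> x xI; have ? := f'E _ xI; have ? := f''E _ xI.
  rewrite /A; apply: is_derive_eq => /=.
  by rewrite /GRing.scale/=; ring.
have dB : {in `]0, L[, forall x : R, is_derive x (1 : R) B 0}.
  move=> x xI; have ? := f'E _ xI; have ? := f''E _ xI.
  rewrite /B; apply: is_derive_eq => /=.
  by rewrite /GRing.scale/=; ring.
have fE x : x \in `]0, L[ -> f x = A x0 * C x + B x0 * S x.
  move=> xI; rewrite (cst_on_itv dA x0I xI) (cst_on_itv dB x0I xI) /A /B.
  by rewrite -[LHS]mulr1 -(W x); ring.
have cC x : C y @[y --> x] --> C x.
  by apply: differentiable_continuous; apply/derivable1_diffP.
have cS x : S y @[y --> x] --> S x.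
  by apply: differentiable_continuous; apply/derivable1_diffP.
have cg x : (A x0 * C y + B x0 * S y) @[y --> x] --> A x0 * C x + B x0 * S x.
  exact: (cvgD (cvgM (cvg_cst (A x0)) (cC x)) (cvgM (cvg_cst (B x0)) (cS x))).
have [_ cf0 cfL] := (continuous_within_itvP f L0).1 cf.
have E0 : f 0 = A x0 * C 0 + B x0 * S 0.
  apply: (cvg_unique _ cf0) => //.
  apply: cvg_trans (cvg_at_right_filter (cg 0)).
  apply: near_eq_cvg; near=> y.
  have yI : y \in `]0, L[.
    by rewrite in_itv/=; apply/andP; split; near: y; [exact: nbhs_right_gt|exact: nbhs_right_lt].
  by rewrite fE.
have EL : f L = A x0 * C L + B x0 * S L.
  apply: (cvg_unique _ cfL) => //.
  apply: cvg_trans (cvg_at_left_filter (cg L)).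
  apply: near_eq_cvg; near=> y.
  have yI : y \in `]0, L[.
    by rewrite in_itv/=; apply/andP; split; near: y; [exact: nbhs_left_gt|exact: nbhs_left_lt].
  by rewrite fE.
have A0 : A x0 = 0 by move: E0; rewrite f0 C0 S0 mulr1 mulr0 addr0.
move: EL; rewrite A0 fL mul0r add0r => /esym/eqP; rewrite mulf_eq0.
have B0 : B x0 != 0.
  by apply: contraNneq fx0 => B0; rewrite (fE _ x0I) A0 B0 !mul0r addr0.
rewrite (negbTE B0)/= => /eqP SL; split=> //; exists (B x0) => x.
rewrite in_itv/= => /andP[]; rewrite le_eqVlt => /predU1P[<-|x_gt0].
  by rewrite f0 S0 mulr0.
rewrite le_eqVlt => /predU1P[->|xL]; first by rewrite fL SL mulr0.
by rewrite fE ?A0 ?mul0r ?add0r// in_itv/= x_gt0.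
Unshelve. all: by end_near.
Qed.

Lemma sin_natpi (k : nat) (x : R) : (sin (x + k%:R * pi) == 0) = (sin x == 0).
Proof.
elim: k => [|k IH]; first by rewrite mul0r addr0.
by rewrite -natr1 mulrDl mul1r addrA sinDpi oppr_eq0.
Qed.

Lemma sin_eq0_pos (y : R) : 0 < y -> sin y = 0 ->
  exists2 k : nat, (1 <= k)%N & y = k%:R * pi.
Proof.
move=> y0 sy; have pi0 := pi_gt0 R.
have ypi : 0 <= y / pi by rewrite divr_ge0// ltW.
have /andP[k1 k2] := truncn_itv ypi; set k := Num.truncn _ in k1 k2.
have yk1 : k%:R * pi <= y by rewrite -ler_pdivlMr.
have yk2 : y < k.+1%:R * pi by rewrite -ltr_pdivrMr.
have s0 : sin (y - k%:R * pi) = 0.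
  by apply/eqP; rewrite -(sin_natpi k) subrK sy.
have yk : y = k%:R * pi.
  apply/eqP; rewrite eq_le yk1 andbT leNgt; apply/negP => lt.
  have : 0 < sin (y - k%:R * pi).
    apply: sin_gt0_pi; rewrite subr_gt0 lt/= ltrBlDr.
    by rewrite (lt_le_trans yk2)// -natr1 mulrDl mul1r addrC.
  by rewrite s0 ltxx.
exists k => //; rewrite lt0n; apply: contraTneq y0 => k0.
by rewrite yk k0 mul0r ltxx.
Qed.

Lemma is_derive_sinM (k x : R) :
  is_derive x (1 : R) (fun x => sin (k * x)) (k * cos (k * x)).
Proof. by apply: is_derive_eq; rewrite /GRing.scale/=; ring. Qed.

Lemma is_derive_cosM (k x : R) :
  is_derive x (1 : R) (fun x => cos (k * x)) (- k * sin (k * x)).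
Proof. by apply: is_derive_eq; rewrite /GRing.scale/=; ring. Qed.

Lemma is_derive_expM (k x : R) :
  is_derive x (1 : R) (fun x => expR (k * x)) (k * expR (k * x)).
Proof. by apply: is_derive_eq; rewrite /GRing.scale/=; ring. Qed.

(* The i-th eigenfunction is, up to a scalar, sin (i pi x / L). *)
Lemma dirichlet_eigensystem_sin L : 0 < L ->
  dirichlet_eigensystem L (fun i => (i%:R * pi / L) ^+ 2)
    (fun i x => sin (i%:R * pi / L * x)).
Proof.
move=> L0; have pi0 := pi_gt0 R; split.
- move=> i i1; set k := _ / L.
  have k0 : 0 < k by rewrite /k divr_gt0// mulr_gt0// ltr0n.
  have d1 : derive1 (fun x : R => sin (k * x)) = (fun x => k * cos (k * x)).
    by apply/funext => x; rewrite derive1E; have [_] := is_derive_sinM k x.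
  have d2 x : is_derive x (1 : R) (fun x : R => k * cos (k * x)) (- (k ^+ 2 * sin (k * x))).
    have ? := is_derive_cosM k x.
    by apply: is_derive_eq; rewrite /GRing.scale/=; ring.
  split.
  + apply: derivable_within_continuous => x _.
    by have [] := is_derive_sinM k x.
  + rewrite mulr0 sin0; split=> //.
    rewrite /k divfK ?gt_eqF//.
    by apply/eqP; rewrite -[_ * pi]add0r sin_natpi sin0.
  + exists (L / (2 * i%:R)).
      rewrite in_itv/= divr_gt0 ?mulr_gt0 ?ltr0n//=.
      rewrite ltr_pdivrMr ?mulr_gt0 ?ltr0n//.
      rewrite ltr_pMr//.
      have : 1 <= i%:R :> R by rewrite ler1n.
      lra.
    rewrite (_ : k * _ = pi / 2) ?sin_pihalf ?oner_eq0//.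
    by rewrite /k; field; rewrite !gt_eqF ?ltr0n.
  + move=> x _; rewrite d1; split.
    * by have [] := is_derive_sinM k x.
    * by have [] := d2 x.
    * by rewrite derive1E; have [_ ->] := d2 x; rewrite opprK.
- move=> i j i1 ij; rewrite ltr_pXn2r// ?nnegrE; last 2 first.
  + by rewrite divr_ge0 ?mulr_ge0 ?ler0n// ltW.
  + by rewrite divr_ge0 ?mulr_ge0 ?ler0n// ltW.
  by rewrite ltr_pM2r ?invr_gt0// ltr_pM2r// ltr_nat.
- move=> l f lf; have [l0|l0|l0] := ltgtP l 0.
  + pose n := Num.sqrt (- l); have n0 : 0 < n by rewrite sqrtr_gt0 oppr_gt0.
    have n2 : n ^+ 2 = - l by rewrite sqr_sqrtr// oppr_ge0 ltW.
    pose ch x := (expR (n * x) + expR (- n * x)) / 2.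
    pose sh x := (expR (n * x) - expR (- n * x)) / 2.
    have dch x : is_derive x (1 : R) ch (n * sh x).
      have ? := is_derive_expM n x; have ? := is_derive_expM (- n) x.
      by apply: is_derive_eq; rewrite /sh /GRing.scale/=; field.
    have dsh x : is_derive x (1 : R) sh (n * ch x).
      have ? := is_derive_expM n x; have ? := is_derive_expM (- n) x.
      by apply: is_derive_eq; rewrite /ch /GRing.scale/=; field.
    have [] := @dirichlet_fundamental L l f ch (fun x => n * sh x)
      (fun x => sh x / n) ch L0 lf.
    * move=> x; have ? := dsh x; apply: is_derive_eq.
      by rewrite /GRing.scale/=; field; rewrite gt_eqF.
    * move=> x; have ? := dsh x; apply: is_derive_eq.
      by rewrite /GRing.scale/= -n2; ring.
    * move=> x; have ? := dch x; apply: is_derive_eq.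
      by rewrite /GRing.scale/= -n2; field; rewrite gt_eqF.
    * move=> x; have e : expR (n * x) * expR (- n * x) = 1.
        by rewrite -expRD mulNr subrr expR0.
      by rewrite -e /ch /sh; field; rewrite gt_eqF.
    * by rewrite /ch !mulr0 expR0; field.
    * by rewrite /sh !mulr0 expR0 subrr !mul0r.
    move=> /eqP; rewrite mulf_eq0 invr_eq0 (gt_eqF n0) orbF.
    rewrite /sh mulf_eq0 invr_eq0 pnatr_eq0 orbF subr_eq0 => /eqP /expR_inj /eqP.
    by rewrite -subr_eq0 mulNr opprK gt_eqF// addr_gt0// mulr_gt0.
  + pose m := Num.sqrt l; have m0 : 0 < m by rewrite sqrtr_gt0.
    have m2 : m ^+ 2 = l by rewrite sqr_sqrtr// ltW.
    have [] := @dirichlet_fundamental L l f (fun x => cos (m * x))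
      (fun x => - m * sin (m * x)) (fun x => sin (m * x) / m)
      (fun x => cos (m * x)) L0 lf.
    * by move=> x; exact: is_derive_cosM.
    * move=> x; have ? := is_derive_sinM m x; apply: is_derive_eq.
      by rewrite /GRing.scale/=; field; rewrite gt_eqF.
    * move=> x; have ? := is_derive_sinM m x; apply: is_derive_eq.
      by rewrite /GRing.scale/= -m2; ring.
    * move=> x; have ? := is_derive_cosM m x; apply: is_derive_eq.
      by rewrite -m2; field; rewrite gt_eqF.
    * by move=> x; rewrite -(cos2Dsin2 (m * x)); field; rewrite gt_eqF.
    * by rewrite mulr0 cos0.
    * by rewrite mulr0 sin0 mul0r.
    move=> /eqP; rewrite mulf_eq0 invr_eq0 (gt_eqF m0) orbF => /eqP smL [b fb].
    have [k k1 mLk] := sin_eq0_pos (mulr_gt0 m0 L0) smL.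
    have mE : m = k%:R * pi / L by rewrite -mLk mulfK ?gt_eqF.
    exists k, (b / m); split => //; first by rewrite -mE.
    by move=> x /fb ->; rewrite -mE; field; rewrite gt_eqF.
  + have [] := @dirichlet_fundamental L l f (fun=> 1) (fun=> 0) id (fun=> 1) L0 lf.
    * by move=> x; rewrite l0 oppr0 mul0r; exact: is_derive_cst.
    * by move=> x; rewrite l0 oppr0 mul0r; exact: is_derive_cst.
    * by move=> x; ring.
    * by [].
    * by [].
    by move=> L00; move: L0; rewrite L00 ltxx.
Qed.

End dirichlet_eigenpairs.

Arguments actuator_span {R} L r M.
Arguments eigen_span {R} L e M.

(* Main.v *)
(* Write u_j for the indicator of the j-th actuator, phi_i = sin(i pi x/L), and
   v_i = sum_j s_ij u_j, where s_ij = phi_i(c_j) is the matrix of the discrete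
   sine transform (DST-II), whose rows are orthogonal. Since <u_j, phi_i> is a
   multiple of s_ij, with a factor depending only on i, the families v and phi
   are biorthogonal, v and phi are each orthogonal, and v spans U. Hence
   P f = sum_i <f, phi_i> / <v_i, phi_i> v_i, and by Bessel's inequality
   |P|^2 = max_i |v_i|^2 |phi_i|^2 / <v_i, phi_i>^2, attained at a phi_i. As
   sin x / x decreases, the maximum is at i = M - 1 among i < M; the row i = M of
   the transform has twice the squared norm of the others, and therefore does not
   compete. The monotonicity in M again comes from that of sin x / x. *)
Require Import Defs.
From HB Require Import structures.
From mathcomp Require Import all_boot all_order all_algebra.
From mathcomp Require Import all_classical all_reals all_analysis.
From mathcomp Require Import measurable_realfun zify ring lra.
Set Implicit Arguments.
Unset Strict Implicit.
Unset Printing Implicit Defensive.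
Import Order.TTheory GRing.Theory Num.Theory.
Import numFieldNormedType.Exports.
Local Open Scope classical_set_scope.
Local Open Scope ring_scope.

(** * The inner product of $L^2$ and closedness of orthogonal complements *)

Lemma polarization_continuous (R : realType) (V : normedModType R) (g : V) :
  continuous (fun f => (`|f + g| ^+ 2 - `|f - g| ^+ 2) / 4 : R).
Proof.
move=> f; apply: cvgM; last exact: cvg_cst.
have cnorm (k : V) : `|h + k| @[h --> f] --> `|f + k|.
  by apply: cvg_norm; apply: cvgD; [exact: cvg_id|exact: cvg_cst].
by apply: cvgB; rewrite ?expr2; apply: cvgM; exact: cnorm.
Qed.

Section L2_dot_theory.
Context d (T : measurableType d) (R : realType).
Context (mu : {measure set T -> \bar R}).
Local Notation L2 := (LspaceType mu (lee1n 2)).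
Implicit Types f g h : L2.

Lemma L2_measurable f : measurable_fun [set: T] (f : T -> R).
Proof. exact: measurable_mfun_class. Qed.

Lemma L2_dot_integrable f g :
  mu.-integrable [set: T] (EFin \o (fun x => f x * g x)).
Proof.
by apply/Lfun1_integrable; apply: Lfun2_mul_Lfun1; exact: Lspace_Lfun.
Qed.

(** Sums and multiples of classes agree with the pointwise ones only almost everywhere, so computing
    an inner product requires a change of representatives. *)
Lemma eq_L2_dot f g (f' g' : T -> R) :
  measurable_fun [set: T] f' -> measurable_fun [set: T] g' ->
  (f : T -> R) = f' %[ae mu] -> (g : T -> R) = g' %[ae mu] ->
  L2_dot f g = \int[mu]_x (f' x * g' x).
Proof.
move=> mf mg ff gg; rewrite /L2_dot /Rintegral; congr fine.
apply: ae_eq_integral => //.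
- by apply/measurable_EFinP; apply: measurable_funM; exact: L2_measurable.
- by apply/measurable_EFinP; exact: measurable_funM.
- by apply: filterS2 ff gg => x /(_ I) <- /(_ I) <-.
Qed.

Lemma L2_dotC f g : L2_dot f g = L2_dot g f.
Proof. by apply: eq_Rintegral => x _; rewrite mulrC. Qed.

Lemma L2_dotDl f g h : L2_dot (f + g) h = L2_dot f h + L2_dot g h.
Proof.
rewrite (eq_L2_dot _ (L2_measurable h) (LspaceDE f g) (ae_eq_refl _ _ _)).
  by rewrite -RintegralD//; [apply: eq_Rintegral => x _; rewrite mulrDl|
    exact: L2_dot_integrable..].
by apply: measurable_funD; exact: L2_measurable.
Qed.

Lemma L2_dotZl a f h : L2_dot (a *: f) h = a * L2_dot f h.
Proof.
rewrite (eq_L2_dot _ (L2_measurable h) (LspaceZE a f) (ae_eq_refl _ _ _)).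
  rewrite -RintegralZl//; last exact: L2_dot_integrable.
  by apply: eq_Rintegral => x _; rewrite -mulrA.
by apply: measurable_funM; [exact: measurable_cst|exact: L2_measurable].
Qed.

Lemma L2_dotDr f g h : L2_dot h (f + g) = L2_dot h f + L2_dot h g.
Proof. by rewrite !(L2_dotC h) L2_dotDl. Qed.

Lemma L2_dotZr a f h : L2_dot h (a *: f) = a * L2_dot h f.
Proof. by rewrite !(L2_dotC h) L2_dotZl. Qed.

Lemma L2_dotNl f h : L2_dot (- f) h = - L2_dot f h.
Proof. by rewrite -scaleN1r L2_dotZl mulN1r. Qed.

Lemma L2_dotNr f h : L2_dot h (- f) = - L2_dot h f.
Proof. by rewrite !(L2_dotC h) L2_dotNl. Qed.

Lemma L2_dot0l h : L2_dot 0 h = 0.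
Proof. by rewrite -[0 : L2](scale0r (0 : L2)) L2_dotZl mul0r. Qed.

Lemma L2_dot_suml (I : Type) (s : seq I) (P : pred I) (v : I -> L2) h :
  L2_dot (\sum_(i <- s | P i) v i) h = \sum_(i <- s | P i) L2_dot (v i) h.
Proof.
by elim/big_rec2: _ => [|i a b _ <-]; rewrite ?L2_dot0l ?L2_dotDl.
Qed.

Lemma L2_dot_norm f : L2_dot f f = `|f| ^+ 2.
Proof.
rewrite [`|f|]/(fine _) unlock /=.
rewrite /L2_dot /Rintegral.
under [in RHS]eq_integral => x _ do rewrite powR_mulrn// real_normK ?num_real//.
have i0 : (0 <= \int[mu]_x (f x ^+ 2)%:E)%E.
  by apply: integral_ge0 => x _; rewrite lee_fin sqr_ge0.
have := integrable_fin_num measurableT (L2_dot_integrable f f).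
rewrite /comp/=; under [in X in X -> _]eq_integral do rewrite -expr2.
under [in LHS]eq_integral do rewrite -expr2.
(* Integrability makes the integral finite, so its extended square root is an ordinary one. *)
case: (integral _ _ _) i0 => [x| |]//= x0 _.
by rewrite powR12_sqrt// sqr_sqrtr.
Qed.

Lemma L2_dotE f g : L2_dot f g = (`|f + g| ^+ 2 - `|f - g| ^+ 2) / 4.
Proof.
rewrite -!L2_dot_norm !L2_dotDl !L2_dotDr !L2_dotNl !L2_dotNr (L2_dotC g f).
by field.
Qed.

(** By polarization, continuity of the norm is enough; no Cauchy-Schwarz inequality is called
    for. *)
Lemma L2_dot_continuous g : continuous (fun f => L2_dot f g).
Proof.
rewrite (_ : (fun _ => _) =
    fun f => (`|f + g| ^+ 2 - `|f - g| ^+ 2) / 4); last first.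
  by apply/funext => h; rewrite L2_dotE.
exact: polarization_continuous.
Qed.

Lemma closed_subspace_orthocomp (A : set L2) : closed_subspace (orthocomp A).
Proof.
split.
- rewrite (_ : orthocomp A =
    \bigcap_(g in A) ((fun f => L2_dot f g) @^-1` [set x | x = 0])); last first.
    by apply/seteqP; split => f Af g /Af.
  apply: closed_bigI => g _; apply: preimage_closed; last exact: closed_eq.
  by move=> f _; exact: L2_dot_continuous.
- by move=> g _; rewrite L2_dot0l.
- move=> a x y Ax Ay g Ag.
  by rewrite L2_dotDl L2_dotZl Ax// Ay// mulr0 addr0.
Qed.

End L2_dot_theory.

(** * Oblique projections given by biorthogonal families, and their norm *)

Section oblique_projection_biorthogonal.
Context d (T : measurableType d) (R : realType).
Context (mu : {measure set T -> \bar R}) (I : finType).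
Local Notation L2 := (LspaceType mu (lee1n 2)).
Implicit Types (v w phi : I -> L2) (p q a b : I -> R) (f : L2).

Definition biorthogonal v w p :=
  forall i k, L2_dot (v i) (w k) = if i == k then p i else 0.

Lemma biorthogonal_dot v w p a k : biorthogonal v w p ->
  L2_dot (\sum_i a i *: v i) (w k) = a k * p k.
Proof.
move=> vw; rewrite L2_dot_suml (bigD1 k)//= big1 => [|i ik]; last first.
  by rewrite L2_dotZl vw (negbTE ik) mulr0.
by rewrite L2_dotZl vw eqxx addr0.
Qed.

Lemma orthogonal_norm v p a : biorthogonal v v p ->
  `|\sum_i a i *: v i| ^+ 2 = \sum_i a i ^+ 2 * p i.
Proof.
move=> vv; rewrite -L2_dot_norm L2_dot_suml; apply: eq_bigr => i _.
by rewrite L2_dotZl L2_dotC (biorthogonal_dot _ _ vv) mulrA -expr2.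
Qed.

(** Expand [0 <= |f - s|^2], where [s] is the orthogonal projection of [f] onto the span of
    [phi]. *)
Lemma bessel phi (c : R) f : 0 < c -> biorthogonal phi phi (fun=> c) ->
  \sum_i L2_dot f (phi i) ^+ 2 <= c * `|f| ^+ 2.
Proof.
move=> c0 pp; pose s := \sum_i (L2_dot f (phi i) / c) *: phi i.
have sf : L2_dot s f = (\sum_i L2_dot f (phi i) ^+ 2) / c.
  rewrite L2_dot_suml mulr_suml; apply: eq_bigr => i _.
  by rewrite L2_dotZl (L2_dotC (phi i)) expr2 mulrAC.
have ss : L2_dot s s = (\sum_i L2_dot f (phi i) ^+ 2) / c.
  rewrite L2_dot_norm (orthogonal_norm _ pp) mulr_suml.
  by apply: eq_bigr => i _; field; rewrite gt_eqF.
have : 0 <= `|f - s| ^+ 2 by exact: sqr_ge0.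
rewrite -(L2_dot_norm (f - s)).
rewrite L2_dotDl !L2_dotDr !L2_dotNl !L2_dotNr ss (L2_dotC f) sf.
by rewrite L2_dot_norm -ler_pdivrMl// mulrC => ?; lra.
Qed.

Context (U E : set L2) (v phi : I -> L2) (p q : I -> R) (c : R).
Context (UE : U = [set f | exists a : I -> R, f = \sum_i a i *: v i]).
Context (EE : E = [set f | exists a : I -> R, f = \sum_i a i *: phi i]).
Context (vv : biorthogonal v v p) (vphi : biorthogonal v phi q).
Context (phiphi : biorthogonal phi phi (fun=> c)).
Context (p0 : forall i, 0 < p i) (q0 : forall i, q i != 0) (c0 : 0 < c).

Let P f := \sum_i (L2_dot f (phi i) / q i) *: v i.

Lemma biorthogonal_orthocompE f :
  orthocomp E f <-> forall i, L2_dot f (phi i) = 0.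
Proof.
split=> [Ef i|f0 g].
  apply: Ef; rewrite EE; exists (fun k => (k == i)%:R).
  rewrite (bigD1 i)//= eqxx scale1r big1 ?addr0// => k /negbTE ->.
  by rewrite scale0r.
rewrite EE => -[a ->]; rewrite L2_dotC L2_dot_suml big1// => i _.
by rewrite L2_dotZl L2_dotC f0 mulr0.
Qed.

(* Makes [U] closed, as an orthogonal complement. *)
Lemma biorthogonal_bicomp : U = orthocomp (orthocomp U).
Proof.
apply/seteqP; split=> [f Uf g /(_ f Uf)|f Uf]; first by rewrite L2_dotC.
(* [s] is the orthogonal projection of [f] onto [U]. The difference [f - s] is orthogonal to [U],
   hence to [s], and also to [f], hence to itself. *)
pose s := \sum_i (L2_dot f (v i) / p i) *: v i.
have Us : U s by rewrite UE; exists (fun i => L2_dot f (v i) / p i).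
suff fs : f - s = 0 by rewrite -[f](subrK s) fs add0r.
have Ufs : orthocomp U (f - s).
  rewrite UE => g [a ->]; rewrite L2_dotC L2_dot_suml big1// => i _.
  rewrite L2_dotZl L2_dotC L2_dotDl L2_dotNl (biorthogonal_dot _ _ vv).
  by rewrite divfK ?gt_eqF// subrr mulr0.
apply/eqP; rewrite -normr_eq0 -sqrf_eq0 -L2_dot_norm L2_dotDl L2_dotNl.
by rewrite (Uf _ Ufs) (L2_dotC s) (Ufs _ Us) subrr.
Qed.

(** Pairing $f=y+z$ with [phi k] kills $z\in E^\perp$ and leaves [q k] times the [k]-th coefficient
    of $y$. This yields both existence, with $y$ = [P f], and uniqueness. *)
Lemma biorthogonal_direct_sum : is_direct_sum U (orthocomp E).
Proof.
split; [by rewrite biorthogonal_bicomp; exact: closed_subspace_orthocomp|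
        exact: closed_subspace_orthocomp|move=> f].
exists (P f, f - P f); split=> /=.
  split; [by rewrite UE; exists (fun i => L2_dot f (phi i) / q i)| |
          by rewrite addrC subrK].
  apply/biorthogonal_orthocompE => k.
  by rewrite L2_dotDl L2_dotNl (biorthogonal_dot _ _ vphi) divfK ?subrr.
move=> [y z] /= []; rewrite UE => -[a ->] /biorthogonal_orthocompE Ez fyz.
have -> : P f = \sum_i a i *: v i.
  apply: eq_bigr => i _.
  by rewrite fyz L2_dotDl Ez addr0 (biorthogonal_dot _ _ vphi) mulfK.
by rewrite fyz [X in X - _]addrC addrK.
Qed.

Lemma biorthogonal_oblique_projE f : oblique_proj U (orthocomp E) f = P f.
Proof.
have [] := oblique_projP f biorthogonal_direct_sum.
move: (oblique_proj _ _ _) => y; rewrite {1}UE => -[a ->].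
move=> /biorthogonal_orthocompE Ez; apply: eq_bigr => i _.
move: (Ez i); rewrite L2_dotDl L2_dotNl (biorthogonal_dot _ _ vphi).
by move=> /eqP; rewrite subr_eq0 => /eqP ->; rewrite mulfK.
Qed.

Lemma biorthogonal_op_norm m :
  (forall i, p i / q i ^+ 2 <= p m / q m ^+ 2) ->
  op_norm (oblique_proj U (orthocomp E)) =
  (Num.sqrt (c * (p m / q m ^+ 2)))%:E.
Proof.
move=> maxm.
have Pnorm f : `|oblique_proj U (orthocomp E) f| ^+ 2 =
    \sum_i L2_dot f (phi i) ^+ 2 * (p i / q i ^+ 2).
  rewrite biorthogonal_oblique_projE (orthogonal_norm _ vv).
  by apply: eq_bigr => i _; field.
have K0 : 0 <= p m / q m ^+ 2 by rewrite divr_ge0 ?sqr_ge0// ltW.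
apply/eqP; rewrite eq_le; apply/andP; split.
  (* Upper bound, on squares: bound each ratio by the one at [m], then apply Bessel's inequality. *)
  apply: ge_ereal_sup => _ [f f1 <-]; rewrite lee_fin.
  rewrite -(ler_pXn2r (ltn0Sn 1)) ?nnegrE ?sqrtr_ge0//.
  rewrite sqr_sqrtr; last by rewrite mulr_ge0// ltW.
  rewrite Pnorm.
  apply: (@le_trans _ _ (\sum_i L2_dot f (phi i) ^+ 2 * (p m / q m ^+ 2))).
    by apply: ler_sum => i _; rewrite ler_wpM2l ?sqr_ge0.
  rewrite -mulr_suml ler_wpM2r//; apply: le_trans (bessel f c0 phiphi) _.
  by rewrite ler_piMr ?expr_le1// ltW.
(* Since [phi m] has squared norm [c], this is a unit vector; only the term [m] of [Pnorm] survives
   on it. *)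
apply: ereal_sup_ubound; exists ((Num.sqrt c)^-1 *: phi m).
  rewrite /= -(ler_pXn2r (ltn0Sn 1)) ?nnegrE//.
  rewrite -L2_dot_norm L2_dotZl L2_dotZr phiphi eqxx mulrA -invfM.
  by rewrite -expr2 (sqr_sqrtr (ltW c0)) mulVf ?gt_eqF// expr1n.
congr EFin; apply/eqP.
rewrite -(eqrXn2 (ltn0Sn 1)) ?sqrtr_ge0//; apply/eqP.
rewrite Pnorm sqr_sqrtr; last by rewrite mulr_ge0// ltW.
rewrite (bigD1 m)//= big1 => [|i im].
  rewrite L2_dotZl phiphi eqxx addr0 exprMn exprVn (sqr_sqrtr (ltW c0)).
  by field; rewrite q0 gt_eqF.
by rewrite L2_dotZl phiphi eq_sym (negbTE im) mulr0 expr0n mul0r.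
Qed.

End oblique_projection_biorthogonal.

(** * Trigonometric sums and the discrete sine transform *)

Section trigonometry.
Context (R : realType).
Implicit Types (h x y t : R).

(** Strict decrease of $\sin x/x$ with denominators cleared: by the mean value theorem the slopes of
    $\sin$ on $[0,x]$ and $[x,y]$ are $\cos u>\cos w$ with $u<w$. *)
Lemma sin_mul_ltr x y : 0 < x -> x < y -> y <= pi -> x * sin y < y * sin x.
Proof.
move=> x0 xy ypi.
have dsin z : is_derive z (1 : R) sin (cos z) by exact: is_derive_sin.
have cont (A : set R) : {within A, continuous sin}.
  by apply: continuous_subspaceT; exact: continuous_sin.
have [u] := MVT x0 (fun z _ => dsin z) (cont _).
rewrite in_itv/= subr0 sin0 subr0 => /andP[u0 ux] sx.
have [w] := MVT xy (fun z _ => dsin z) (cont _).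
rewrite in_itv/= => /andP[xw wy] sy.
have cwu : cos w < cos u.
  rewrite ltr_cos ?(lt_trans ux)// in_itv/=.
    by rewrite (ltW u0)/= (ltW (lt_trans ux (lt_le_trans xy ypi))).
  by rewrite (ltW (lt_trans x0 xw))/= (ltW (lt_le_trans wy ypi)).
rewrite -subr_gt0 [X in 0 < X](_ : _ = x * (y - x) * (cos u - cos w)).
  by rewrite !mulr_gt0 ?subr_gt0.
by rewrite -(subrK (sin x) (sin y)) sy sx; ring.
Qed.

(** Multiplied by $2\sin h$, each cosine becomes a difference of sines at consecutive even multiples
    of $h$, and the sum telescopes. *)
Lemma sum_cos_odd (M : nat) h :
  2 * sin h * \sum_(j < M) cos ((2 * j + 1)%:R * h) = sin ((2 * M)%:R * h).
Proof.
rewrite -(big_mkord xpredT (fun j => cos ((2 * j + 1)%:R * h))) mulr_sumr.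
transitivity (\sum_(0 <= j < M)
    (sin ((2 * j.+1)%:R * h) - sin ((2 * j)%:R * h))).
  apply: eq_big_nat => j _.
  rewrite (_ : (2 * j.+1)%:R * h = (2 * j + 1)%:R * h + h); last first.
    by rewrite mulnS !natrD; ring.
  rewrite (_ : (2 * j)%:R * h = (2 * j + 1)%:R * h - h); last first.
    by rewrite !natrD; ring.
  by rewrite sinD sinB; ring.
by rewrite telescope_sumr// muln0 mul0r sin0 subr0.
Qed.

Lemma sin_pi_natM (k : nat) : sin (k%:R * pi) = 0 :> R.
Proof. by apply/eqP; rewrite -[_ * pi]add0r sin_natpi sin0. Qed.

(* The actuator center c_(j+1) is [dst_node M j * L / pi]. *)
Definition dst_node (M : nat) (j : nat) : R := (2 * j + 1)%:R * (pi / (2 * M)%:R).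

(** Take $h=m\pi/(2M)$ in [sum_cos_odd]: the right side is $\sin(m\pi)=0$, while $0<h<\pi$ makes
    $\sin h$ nonzero. *)
Lemma sum_cos_dst_node (M m : nat) : (0 < m < 2 * M)%N ->
  \sum_(j < M) cos (m%:R * dst_node M j) = 0.
Proof.
move=> /andP[m0 mM]; have M0 : 0 < M%:R :> R by rewrite ltr0n; lia.
have := sum_cos_odd M (m%:R * (pi / (2 * M)%:R)).
rewrite (_ : (2 * M)%:R * _ = m%:R * pi); last by field; rewrite gt_eqF.
rewrite sin_pi_natM => /eqP; rewrite !mulf_eq0 pnatr_eq0/= gt_eqF/=.
  by move=> /eqP s0; rewrite -[RHS]s0; apply: eq_bigr => j _; rewrite /dst_node; congr cos; ring.
apply: sin_gt0_pi; rewrite mulr_gt0 ?divr_gt0 ?pi_gt0 ?ltr0n//=; last by lia.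
rewrite mulrA ltr_pdivrMr ?natrM ?mulr_gt0// mulrC ltr_pM2l ?pi_gt0//.
by rewrite -natrM ltr_nat.
Qed.

(** The excluded frequency $2M$: every angle is an odd multiple of $\pi$. This is the source of the
    doubled weight of the last row. *)
Lemma sum_cos_dst_node_alt (M : nat) :
  \sum_(j < M) cos ((2 * M)%:R * dst_node M j) = - M%:R.
Proof.
have [->|M0] := posnP M; first by rewrite big_ord0 oppr0.
rewrite (eq_bigr (fun=> -1)); first by rewrite sumr_const card_ord mulNrn.
move=> j _; rewrite /dst_node.
rewrite (_ : _ * _ = pi + (pi *+ 2) *+ j); last first.
  rewrite mulrnA natrD natrM; field.
  by rewrite pnatr_eq0 -lt0n M0.
by rewrite (periodicn (@cosD2pi R)) cospi.
Qed.

(** Numbered from 0: row [i] belongs to the mode $i+1$ and column [j] to the actuator $j+1$. *)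
Definition dst (M : nat) (i j : nat) : R := sin (i.+1%:R * dst_node M j).

(* The squared norm of row [i] of [dst M]. *)
Definition dst_weight (M : nat) (i : nat) : R :=
  if i.+1 == M then M%:R else M%:R / 2.

Lemma dst_weight_gt0 (M i : nat) : (i < M)%N -> 0 < dst_weight M i.
Proof.
move=> iM; have M0 : 0 < M%:R :> R by rewrite ltr0n (leq_trans _ iM).
by rewrite /dst_weight; case: ifP => _//; rewrite divr_gt0.
Qed.

Lemma dst_orthogonal (M : nat) (i k : 'I_M) :
  \sum_(j < M) dst M i j * dst M k j = if i == k then dst_weight M i else 0.
Proof.
(* By symmetry, so that the truncated subtraction [i - k] is a true difference. *)
wlog ki : i k / (k <= i)%N => [hw|].
  have [/hw//|/ltnW /hw] := leqP k i.
  under eq_bigr do rewrite mulrC.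
  by rewrite eq_sym; case: eqP => [->|].
have -> : \sum_(j < M) dst M i j * dst M k j =
    (\sum_(j < M) cos ((i - k)%:R * dst_node M j) -
     \sum_(j < M) cos ((i.+1 + k.+1)%:R * dst_node M j)) / 2.
  rewrite -sumrB mulr_suml; apply: eq_bigr => j _; rewrite /dst.
  rewrite (_ : (i - k)%:R * _ = i.+1%:R * dst_node M j - k.+1%:R * dst_node M j).
    by rewrite (natrD _ i.+1 k.+1) (mulrDl _ _ (dst_node M j)) cosB cosD; field.
  by rewrite natrB// -!natr1; ring.
have iM := ltn_ord i; have kM := ltn_ord k.
(* The frequencies are $i-k$ and $i+k+2\le 2M$; the latter reaches $2M$ only for $i=k=M-1$. *)
have [<-{k ki kM}|ik] := eqVneq i k.
  rewrite subnn (eq_bigr (fun=> 1)) => [|j _]; last by rewrite mul0r cos0.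
  rewrite sumr_const card_ord addnn -mul2n /dst_weight.
  case: eqP => iM1.
    by rewrite iM1 sum_cos_dst_node_alt; field.
  by rewrite sum_cos_dst_node ?subr0//; lia.
have ki' : (k < i)%N by rewrite ltn_neqAle ki eq_sym andbT.
by rewrite !sum_cos_dst_node ?subrr ?mul0r//; lia.
Qed.

(** Orthogonality of the rows gives a right inverse of a square matrix, which is also a left
    inverse; reading that off gives the relations between columns. *)
Lemma dst_complete (M : nat) (j k : 'I_M) :
  \sum_(i < M) dst M i j * dst M i k / dst_weight M i = (j == k)%:R.
Proof.
pose A := \matrix_(i < M, j < M) dst M i j.
pose B := \matrix_(j < M, i < M) (dst M i j / dst_weight M i).
have AB : A *m B = 1%:M.
  apply/matrixP => i l; rewrite !mxE.
  rewrite (eq_bigr (fun j : 'I_M => dst M i j * dst M l j / dst_weight M l)); last first.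
    by move=> s _; rewrite !mxE mulrA.
  rewrite -mulr_suml dst_orthogonal; case: eqP => [->|_]; last by rewrite mul0r.
  by rewrite divff// gt_eqF// dst_weight_gt0.
have := mulmx1C AB => /matrixP/(_ j k); rewrite !mxE => <-.
by apply: eq_bigr => i _; rewrite !mxE mulrAC.
Qed.

End trigonometry.

(** * Integration against a restricted measure *)

Section restricted_measure.
Context d (T : measurableType d) (R : realType).
Context (mu : {measure set T -> \bar R}) (D : set T) (mD : measurable D).

(** The complement of [D] is null for the restricted measure, so identities known only on $(0,L)$
    will suffice. *)
Lemma ae_mrestr (P : T -> Prop) : (forall x, D x -> P x) ->
  {ae mrestr mu mD, forall x, P x}.
Proof.
move=> DP; exists (~` D); split; [exact: measurableC| |].
  by rewrite /mrestr setICl measure0.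
by move=> x /= nPx Dx; exact/nPx/DP.
Qed.

(** Cutting [f] off outside [D] changes it on a null set only, and the two measures coincide on
    subsets of [D]. *)
Lemma integral_mrestr (f : T -> \bar R) : measurable_fun [set: T] f ->
  (\int[mrestr mu mD]_x f x = \int[mu]_(x in D) f x)%E.
Proof.
move=> mf; transitivity (\int[mrestr mu mD]_x (f \_ D) x)%E.
  apply: ae_eq_integral => //.
    by apply/(measurable_restrictT _ mD).1; exact: measurable_funTS.
  by apply: ae_mrestr => x Dx _; rewrite patchE mem_set.
rewrite -integral_mkcond; apply: eq_measure_integral => A mA AD.
by rewrite /= /mrestr setIidl.
Qed.

End restricted_measure.

(** * Bounded functions and finite spans in $L^2$ *)

Section L2_bounded.
Context d (T : measurableType d) (R : realType).
Context (mu : {measure set T -> \bar R}).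
Local Notation L2 := (LspaceType mu (lee1n 2)).

Lemma bounded_Lfun2 (f : T -> R) (K : R) : (mu [set: T] < +oo)%E ->
  measurable_fun [set: T] f -> (forall x, `|f x| <= K) ->
  f \in Lfun mu 2%:E.
Proof.
move=> muT mf fK; rewrite inE; apply/andP; split; rewrite inE//=.
rewrite /finite_norm unlock poweR_lty//.
apply: (@le_lt_trans _ _ (\int[mu]_x (cst (K `^ 2)%:E x))%E).
  apply: ge0_le_integral => //=.
  - apply/measurable_EFinP.
    apply: (@measurableT_comp _ _ _ _ _ _ (fun x : R => x `^ 2)%R) => //.
    exact: measurableT_comp.
  - move=> x _; rewrite lee_fin ge0_ler_powR ?nnegrE ?ler0n//.
    exact: le_trans (fK x).
rewrite integral_cst// lte_mul_pinfty// ?lee_fin ?powR_ge0//.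
Qed.

Lemma L2_of_bounded (f : T -> R) (K : R) : (mu [set: T] < +oo)%E ->
  measurable_fun [set: T] f -> (forall x, `|f x| <= K) ->
  exists g : L2, (g : T -> R) = f %[ae mu].
Proof.
move=> muT mf fK; have Lf := bounded_Lfun2 muT mf fK.
by exists (Lspace_of (Lfun_Sub (lee1n 2) Lf)); exact: Lspace_ofE.
Qed.

Lemma Lspace_sum_ae (I : Type) (s : seq I) (a : I -> R) (w : I -> L2)
    (u : I -> T -> R) : (forall i, (w i : T -> R) = u i %[ae mu]) ->
  ((\sum_(i <- s) a i *: w i : L2) : T -> R) =
  (fun x => \sum_(i <- s) a i * u i x) %[ae mu].
Proof.
move=> wu; elim: s => [|i s IH].
  rewrite big_nil; apply: ae_eq_trans (Lspace0E _ _) _.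
  by apply: aeW => x _; rewrite big_nil.
rewrite big_cons; apply: ae_eq_trans (LspaceDE _ _) _.
have wi := wu i; have Zi := LspaceZE (a i) (w i).
near=> x => _; rewrite big_cons /=.
congr (_ + _).
  rewrite (near Zi x)//=; congr (_ * _); exact: (near wi x).
exact: (near IH x).
Unshelve. all: by end_near.
Qed.

Lemma L2_spanE (M : nat) (u : nat -> T -> R) (w : 'I_M -> L2) :
  (forall i, (w i : T -> R) = u i.+1 %[ae mu]) ->
  @L2_span _ _ _ mu u M = [set f | exists a : 'I_M -> R, f = \sum_i a i *: w i].
Proof.
move=> wu; apply/seteqP; split=> f [a fE].
  exists (fun i => a i.+1); apply/Lspace_eqP; apply: ae_eq_trans fE _.
  apply: ae_eq_sym; apply: ae_eq_trans (Lspace_sum_ae _ _ wu) _.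
  by apply: aeW => x _; rewrite big_add1 big_mkord.
(* Coefficients indexed by ['I_M] are shifted to $1,\dots,M$; the default 0 beyond the range is
   never read. *)
exists (fun i => oapp a 0 (insub i.-1)).
rewrite fE; apply: ae_eq_trans (Lspace_sum_ae _ _ wu) _.
apply: aeW => x _; rewrite big_add1 big_mkord; apply: eq_bigr => i _.
by rewrite /= valK.
Qed.

End L2_bounded.

(** * Integrals of sines and cosines *)

Section integrals.
Context (R : realType).
Implicit Types (a b k L r : R) (F f : R -> R).
Local Notation mu := (@lebesgue_measure R).

Lemma Rintegral_oo_FTC F f a b : a < b -> continuous f ->
  (forall x, is_derive x (1 : R) F (f x)) ->
  \int[mu]_(x in `]a, b[) f x = F b - F a.
Proof.
move=> ab cf dF.
have cF : continuous F.
  by move=> x; apply: differentiable_continuous; apply/derivable1_diffP.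
have mf : measurable_fun `]a, b[ (EFin \o f).
  apply/measurable_EFinP; apply: measurable_funTS.
  exact: continuous_measurable_fun.
(* Endpoints are null, so the fundamental theorem on the closed interval applies. *)
rewrite /Rintegral -(integral_itv_bndoo true false mf).
rewrite (continuous_FTC2 ab (F := F))//.
- exact: continuous_subspaceT.
- split; first by move=> x _; have [] := dF x.
    exact: (cvg_at_right_filter (cF a)).
  exact: (cvg_at_left_filter (cF b)).
- by move=> x _; rewrite derive1E; have [_] := dF x.
Qed.

Lemma continuous_sinM k : continuous (fun x => sin (k * x)).
Proof.
move=> x; apply: differentiable_continuous; apply/derivable1_diffP.
by have [] := is_derive_sinM k x.
Qed.

Lemma continuous_cosM k : continuous (fun x => cos (k * x)).
Proof.
move=> x; apply: differentiable_continuous; apply/derivable1_diffP.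
by have [] := is_derive_cosM k x.
Qed.

Lemma Rintegral_sinM k a b : k != 0 -> a < b ->
  \int[mu]_(x in `]a, b[) sin (k * x) = (cos (k * a) - cos (k * b)) / k.
Proof.
move=> k0 ab.
have dF x : is_derive x (1 : R) (fun x => - cos (k * x) / k) (sin (k * x)).
  have ? := is_derive_cosM k x.
  by apply: is_derive_eq; rewrite /GRing.scale/=; field.
by rewrite (Rintegral_oo_FTC ab (@continuous_sinM k) dF); field.
Qed.

Lemma Rintegral_cosM k a b : k != 0 -> a < b ->
  \int[mu]_(x in `]a, b[) cos (k * x) = (sin (k * b) - sin (k * a)) / k.
Proof.
move=> k0 ab.
have dF x : is_derive x (1 : R) (fun x => sin (k * x) / k) (cos (k * x)).
  have ? := is_derive_sinM k x.
  by apply: is_derive_eq; rewrite /GRing.scale/=; field.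
by rewrite (Rintegral_oo_FTC ab (@continuous_cosM k) dF); field.
Qed.

Lemma Rintegral_cos_natpi L (n : nat) : 0 < L ->
  \int[mu]_(x in `]0, L[) cos (n%:R * pi / L * x) = if n == 0%N then L else 0.
Proof.
move=> L0; case: n => [|n] /=.
  rewrite (@eq_Rintegral _ _ _ mu _ (fun=> 1)); last by move=> x _; rewrite !mul0r cos0.
  by rewrite Rintegral_cst//= lebesgue_measure_itv/= lte_fin L0 mul1r/= subr0.
have k0 : n.+1%:R * pi / L != 0.
  by rewrite !mulf_neq0 ?invr_eq0 ?gt_eqF ?pi_gt0.
rewrite Rintegral_cosM// mulr0 sin0 subr0 divfK ?gt_eqF//.
by rewrite sin_pi_natM mul0r.
Qed.

Lemma Rintegral_sin_sin L (i k : nat) : 0 < L ->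
  \int[mu]_(x in `]0, L[)
    (sin (i.+1%:R * pi / L * x) * sin (k.+1%:R * pi / L * x)) =
  if i == k then L / 2 else 0.
Proof.
move=> L0; wlog ki : i k / (k <= i)%N => [hw|].
  have [/hw//|/ltnW /hw] := leqP k i.
  rewrite eq_sym => <-.
  by apply: eq_Rintegral => x _; rewrite mulrC.
have int (n : nat) :
    mu.-integrable `]0, L[ (EFin \o (fun x : R => cos (n%:R * pi / L * x))).
  apply: (@integrableS _ _ R mu `[0, L]%classic) => //; first exact: subset_itv_oo_cc.
  apply: continuous_compact_integrable; first exact: segment_compact.
  by apply: continuous_subspaceT; exact: continuous_cosM.
rewrite (@eq_Rintegral _ _ _ mu _ (fun x => (cos ((i - k)%:R * pi / L * x) -
    cos ((i.+1 + k.+1)%:R * pi / L * x)) * 2^-1)); last first.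
  move=> x _.
  pose t (n : nat) := n%:R * pi / L * x.
  have -> : (i - k)%:R * pi / L * x = t i.+1 - t k.+1.
    by rewrite /t natrB// -!natr1; ring.
  have -> : (i.+1 + k.+1)%:R * pi / L * x = t i.+1 + t k.+1.
    by rewrite /t natrD; ring.
  by rewrite cosB cosD; field.
rewrite RintegralZr//; last first.
  by have := integrableB _ (int (i - k)%N) (int (i.+1 + k.+1)%N); exact.
(* The frequency $i+k+2$ is positive and integrates to zero; only the frequency $i-k$ can
   contribute. *)
rewrite RintegralB// !Rintegral_cos_natpi// subn_eq0 /= subr0.
have [<-|ik] := eqVneq i k; first by rewrite leqnn.
by rewrite leqNgt ltn_neqAle eq_sym ik ki mul0r.
Qed.

End integrals.

(** * Dirichlet eigenfunctions are the sines, up to nonzero scalars *)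

Section dirichlet_sine.
Context (R : realType).
Implicit Types (L : R) (lam : nat -> R) (e : nat -> R -> R).

(** Both [lam] and [nu] list the same set of eigenvalues in strictly increasing order, hence
    coincide; each [e i] is then a multiple of the sine with the same eigenvalue. *)
Lemma dirichlet_eigensystem_sinE L lam e : 0 < L ->
  dirichlet_eigensystem L lam e -> forall i, (1 <= i)%N ->
  exists2 c, c != 0 &
    {in `]0, L[, forall x, e i x = c * sin (i%:R * pi / L * x)}.
Proof.
move=> L0 [ep lam_lt e_all].
pose nu k : R := (k%:R * pi / L) ^+ 2.
have [sp nu_lt s_all] := dirichlet_eigensystem_sin L0.
have nu_inj k l : (1 <= k)%N -> (1 <= l)%N -> nu k = nu l -> k = l.
  move=> k1 l1 kl; have [lt|lt|//] := ltngtP k l.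
    by have := nu_lt _ _ k1 lt; rewrite -/(nu k) -/(nu l) kl ltxx.
  by have := nu_lt _ _ l1 lt; rewrite -/(nu k) -/(nu l) kl ltxx.
have lam_nu i : (1 <= i)%N -> lam i = nu i.
  (* Write [lam i = nu k] and [nu i = lam j]. As the lists agree below [i], strict growth forces
     [i <= k] and [i <= j], which gives the two inequalities. *)
  elim/ltn_ind: i => i IH i1.
  have [k [_ [k1 ik _]]] := s_all _ _ (ep i i1).
  have [j [_ [j1 ji _]]] := e_all _ _ (sp i i1).
  have ki : (i <= k)%N.
    rewrite leqNgt; apply/negP => ki; have := lam_lt _ _ k1 ki.
    by rewrite (IH _ ki k1) ik ltxx.
  have ij : (i <= j)%N.
    rewrite leqNgt; apply/negP => ji'; have := nu_lt _ _ j1 ji'.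
    by rewrite ji -/(nu j) (IH _ ji' j1) ltxx.
  apply/eqP; rewrite eq_le; apply/andP; split.
    rewrite /nu ji; move: ij; rewrite leq_eqVlt => /predU1P[<-//|ij].
    exact/ltW/lam_lt.
  rewrite ik; move: ki; rewrite leq_eqVlt => /predU1P[<-//|ki].
  exact/ltW/nu_lt.
move=> i i1; have [k [c [k1 ik eE]]] := s_all _ _ (ep i i1).
have ki : k = i by apply: nu_inj => //; rewrite -(lam_nu i).
rewrite {k k1 ik}ki in eE.
have eE' : {in `]0, L[, forall x, e i x = c * sin (i%:R * pi / L * x)}.
  by move=> x xI; apply: eE; apply: subset_itv_oo_cc xI.
exists c => //; have [_ _ [x xI ex0] _] := ep i i1.
by apply: contraNneq ex0 => c0; rewrite eE'// c0 mul0r.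
Qed.

Lemma eigen_span_sinE L lam e (M : nat) : 0 < L ->
  dirichlet_eigensystem L lam e ->
  eigen_span L e M =
  eigen_span L (fun i x => sin (i%:R * pi / L * x)) M.
Proof.
move=> L0 es.
have /choice[c ce] : forall i, exists c, (1 <= i)%N -> c != 0 /\
    {in `]0, L[, forall x, e i x = c * sin (i%:R * pi / L * x)}.
  (* Index 0 lies outside the enumeration, so any value will do there. *)
  case=> [|i]; first by exists 0.
  by have [c c0 ce] := dirichlet_eigensystem_sinE L0 es (ltn0Sn i); exists c.
apply/seteqP; split=> f [a fE].
  exists (fun i => a i * c i); apply: ae_eq_trans fE _.
  apply: ae_mrestr => x xI _; apply: eq_big_nat => i /andP[i1 _].
  by have [_ ->] := ce _ i1; rewrite ?mulrA.
exists (fun i => a i / c i); apply: ae_eq_trans fE _.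
apply: ae_mrestr => x xI _; apply: eq_big_nat => i /andP[i1 _].
by have [c0 ->] := ce _ i1; rewrite ?mulrA ?divfK.
Qed.

End dirichlet_sine.

(** * Geometry of the actuators and their pairings with the sines *)

Section actuators.
Context (R : realType) (L r : R) (M : nat).
Context (L0 : 0 < L) (r0 : 0 < r) (r1 : r < 1).
Local Notation mu := (@lebesgue_measure R).
Local Notation L2 := (LspaceType (lebesgue_on L) (lee1n 2)).
Local Notation supp := (actuator_support L r M).

Lemma lebesgue_on_lty : (lebesgue_on L [set: measurableTypeR R] < +oo)%E.
Proof.
by rewrite /= /mrestr setTI lebesgue_measure_itv/= lte_fin L0 ltry.
Qed.

Lemma L2_dot_lebesgue_on (f g : L2) (f' g' : measurableTypeR R -> R) :
  measurable_fun [set: measurableTypeR R] f' ->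
  measurable_fun [set: measurableTypeR R] g' ->
  (f : measurableTypeR R -> R) = f' %[ae lebesgue_on L] ->
  (g : measurableTypeR R -> R) = g' %[ae lebesgue_on L] ->
  L2_dot f g = \int[mu]_(x in `]0, L[) (f' x * g' x).
Proof.
move=> mf mg ff gg; rewrite (eq_L2_dot mf mg ff gg) /Rintegral.
rewrite integral_mrestr//; apply/measurable_EFinP.
exact: measurable_funM.
Qed.

Lemma measurable_indic_supp j : measurable_fun [set: R] (\1_(supp j) : R -> R).
Proof. by apply: measurable_indic; exact: measurable_itv. Qed.

(** With [j] counted from 0 the endpoints are $(2j+1\pm r)L/(2M)$, where $0\le j\le M-1$ and
    $r<1$. *)
Lemma actuator_support_sub (j : 'I_M) : supp j.+1 `<=` `]0, L[.
Proof.
have r_lt1 := r1.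
have M0 : 0 < M%:R :> R by rewrite ltr0n (leq_trans _ (ltn_ord j)).
have jM : j%:R + 1 <= M%:R :> R by rewrite natr1 ler_nat ltn_ord.
have j0 : 0 <= j%:R :> R by rewrite ler0n.
move=> x; rewrite /actuator_support /actuator_center /= !in_itv /=.
rewrite -mulrBl -mulrDl ltr_pdivrMr ?mulr_gt0// ltr_pdivlMr ?mulr_gt0//.
rewrite -[j.+1%:R]natr1 -mulrBl -mulrDl => /andP[x1 x2].
have M2 : 0 < 2 * M%:R :> R by rewrite mulr_gt0.
apply/andP; split.
  rewrite -(pmulr_lgt0 _ M2); apply: lt_trans x1.
  by rewrite mulr_gt0//; lra.
rewrite -(ltr_pM2r M2); apply: lt_le_trans x2 _.
by rewrite mulrC ler_pM2l//; lra.
Qed.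

(** Centers are at least $L/M$ apart, whereas two half-widths add up to $rL/M$ with $r<1$. *)
Lemma actuator_support_disjoint (i j : 'I_M) : i != j ->
  supp i.+1 `&` supp j.+1 = set0.
Proof.
wlog ij : i j / (i < j)%N => [hw|_].
  have [/hw//|/hw|/val_inj->] := ltngtP i j; last by rewrite eqxx.
  by rewrite setIC eq_sym.
have r_lt1 := r1.
have M0 : 0 < M%:R :> R by rewrite ltr0n (leq_trans _ (ltn_ord j)).
have ij1 : i%:R + 1 <= j%:R :> R by rewrite natr1 ler_nat.
apply/seteqP; split=> // x [].
rewrite /actuator_support /actuator_center /= !in_itv /=.
rewrite -!mulrBl -!mulrDl !ltr_pdivrMr ?mulr_gt0// !ltr_pdivlMr ?mulr_gt0//.
rewrite -[i.+1%:R]natr1 -[j.+1%:R]natr1 => /andP[_ x1] /andP[x2 _].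
by have := lt_trans x2 x1; rewrite ltr_pM2r//; lra.
Qed.

Lemma Rintegral_actuator (j : 'I_M) (f : R -> R) :
  \int[mu]_(x in `]0, L[) (\1_(supp j.+1) x * f x) =
  \int[mu]_(x in supp j.+1) f x.
Proof.
rewrite -[in RHS](setIidr (@actuator_support_sub j)) Rintegral_mkcondr.
apply: eq_Rintegral => x _; rewrite patchE indicE.
by case: ifP => _; rewrite ?mul1r ?mul0r.
Qed.

Lemma Rintegral_actuator_actuator (i j : 'I_M) :
  \int[mu]_(x in `]0, L[) (\1_(supp i.+1) x * \1_(supp j.+1) x) =
  if i == j then r * L / M%:R else 0.
Proof.
have M0 : 0 < M%:R :> R by rewrite ltr0n (leq_trans _ (ltn_ord j)).
rewrite Rintegral_actuator; case: eqVneq => [->|ij].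
  rewrite (@eq_Rintegral _ _ _ mu _ (fun=> 1)); last first.
    by move=> x xI; rewrite indicE xI.
  have h0 : 0 < r * L / (2 * M%:R) by rewrite divr_gt0 ?mulr_gt0.
  rewrite Rintegral_cst//; last exact: measurable_itv.
  have muE : mu (supp j.+1) = (r * L / M%:R)%:E.
    apply: etrans (lebesgue_measure_itv _) _; rewrite /= lte_fin ifT; last by lra.
    by rewrite -EFinB; congr EFin; field; rewrite gt_eqF.
  by rewrite mul1r; exact: (congr1 fine muE).
rewrite (@eq_Rintegral _ _ _ mu _ (fun=> 0)); last first.
  move=> x xI; rewrite indicE; case: (boolP (x \in supp j.+1)) => // xJ.
  have : (supp i.+1 `&` supp j.+1) x by split; exact: set_mem.
  by rewrite actuator_support_disjoint.
by rewrite Rintegral_cst ?mul0r//; exact: measurable_itv.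
Qed.

(** This is $2\sin(wh)/w$ for the frequency $w=(k+1)\pi/L$ and the half-width $h=rL/(2M)$. *)
Definition actuator_gain (k : nat) : R :=
  2 * L / (k.+1%:R * pi) * sin (k.+1%:R * (r * pi / (2 * M%:R))).

(** For a center $c$, $\cos(w(c-h))-\cos(w(c+h))=2\sin(wc)\sin(wh)$: position and width separate,
    and $\sin(wc)$ is the entry of [dst]. *)
Lemma Rintegral_actuator_sin (j : 'I_M) (k : nat) :
  \int[mu]_(x in `]0, L[)
    (\1_(supp j.+1) x * sin (k.+1%:R * pi / L * x)) =
  actuator_gain k * dst R M k j.
Proof.
have M0 : 0 < M%:R :> R by rewrite ltr0n (leq_trans _ (ltn_ord j)).
have h0 : 0 < r * L / (2 * M%:R) by rewrite divr_gt0 ?mulr_gt0.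
have pi0 := pi_gt0 R.
have k0 : k.+1%:R * pi / L != 0 by rewrite !mulf_neq0 ?invr_eq0 ?gt_eqF.
rewrite Rintegral_actuator Rintegral_sinM//; last by lra.
pose t := k.+1%:R * (r * pi / (2 * M%:R)).
have kh : k.+1%:R * pi / L * (r * L / (2 * M%:R)) = t.
  by rewrite /t; field; rewrite !gt_eqF.
have kc : k.+1%:R * pi / L * actuator_center L M j.+1 = k.+1%:R * dst_node R M j.
  rewrite /actuator_center /dst_node -[j.+1%:R]natr1 natrD !natrM; field.
  by rewrite !gt_eqF.
rewrite (mulrBr (_ / L)) (mulrDr (_ / L)) kh kc cosB cosD.
have -> : actuator_gain k = 2 / (k.+1%:R * pi / L) * sin t.
  by rewrite /actuator_gain -/t invf_div mulrA.
by move: (_ / L) k0 => w w0; rewrite /dst; field.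
Qed.

End actuators.

(** * Change of basis by the discrete sine transform *)

Section discrete_sine_transform_span.
Context (R : realType) (V : lmodType R) (M : nat) (u : 'I_M -> V).

Lemma dst_span :
  [set f | exists a : 'I_M -> R, f = \sum_j a j *: u j] =
  [set f | exists b : 'I_M -> R,
    f = \sum_i b i *: (\sum_(j < M) dst R M i j *: u j)].
Proof.
apply/seteqP; split=> _ [a ->].
  (* The inverse transform of [a], with the row weights divided out. *)
  exists (fun i : 'I_M => \sum_(j < M) a j * dst R M i j / dst_weight R M i).
  (* A Kronecker delta is inserted so that [dst_complete] can expand it over the rows. *)
  have -> : \sum_j a j *: u j =
      \sum_j \sum_k (a j * (j == k)%:R) *: u k.
    apply: eq_bigr => j _; rewrite (bigD1 j)//= eqxx mulr1 big1 ?addr0//.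
    by move=> k kj; rewrite eq_sym (negbTE kj) mulr0 scale0r.
  under eq_bigr do under eq_bigr do rewrite -dst_complete mulr_sumr scaler_suml.
  under [RHS]eq_bigr do rewrite scaler_suml.
  rewrite [RHS]exchange_big; apply: eq_bigr => j _ /=.
  rewrite exchange_big; apply: eq_bigr => i _ /=.
  rewrite scaler_sumr; apply: eq_bigr => k _.
  by rewrite scalerA; congr (_ *: _); ring.
exists (fun j : 'I_M => \sum_(i < M) a i * dst R M i j).
under eq_bigr do rewrite scaler_sumr.
rewrite exchange_big; apply: eq_bigr => j _ /=.
by rewrite scaler_suml; apply: eq_bigr => i _; rewrite scalerA.
Qed.

End discrete_sine_transform_span.

(** * The biorthogonal families and the worst mode *)

Section oblique_projection_norm.
Context (R : realType) (L r : R).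
Context (L0 : 0 < L) (r0 : 0 < r) (r1 : r < 1).
Local Notation L2 := (LspaceType (lebesgue_on L) (lee1n 2)).
Local Notation sine := (fun (i : nat) (x : R) => sin (i%:R * pi / L * x)).

(** Supplies the data of the abstract setting. Row orthogonality of [dst] gives both relations
    involving [v], so the row weight occurs in both diagonals. *)
Lemma actuator_biorthogonal (M : nat) : exists v phi : 'I_M -> L2,
  [/\ actuator_span L r M = [set f | exists a : 'I_M -> R, f = \sum_i a i *: v i],
      eigen_span L sine M = [set f | exists a : 'I_M -> R, f = \sum_i a i *: phi i],
      biorthogonal v v (fun i : 'I_M => r * L / M%:R * dst_weight R M i),
      biorthogonal v phi (fun i : 'I_M => actuator_gain L r M i * dst_weight R M i) &
      biorthogonal phi phi (fun=> L / 2)].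
Proof.
have msine i : measurable_fun [set: measurableTypeR R] (sine i).
  by apply: continuous_measurable_fun; exact: continuous_sinM.
have /choice[u uE] : forall i : 'I_M, exists u : L2,
    (u : measurableTypeR R -> R) =
    \1_(actuator_support L r M i.+1) %[ae lebesgue_on L].
  move=> i; apply: (L2_of_bounded (lebesgue_on_lty L0) (K := 1)).
    exact: measurable_indic_supp.
  by move=> x; rewrite indicE; case: (_ \in _); rewrite ?normr1 ?normr0.
have /choice[phi phiE] : forall i : 'I_M, exists u : L2,
    (u : measurableTypeR R -> R) = sine i.+1 %[ae lebesgue_on L].
  move=> i; apply: (L2_of_bounded (lebesgue_on_lty L0) (K := 1)) => //.
  by move=> x; exact: sin_max.
have uu : biorthogonal u u (fun=> r * L / M%:R).
  move=> i k; rewrite (L2_dot_lebesgue_on _ _ (uE i) (uE k)).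
  - exact: Rintegral_actuator_actuator.
  - exact: measurable_indic_supp.
  - exact: measurable_indic_supp.
have uphi i k : L2_dot (u i) (phi k) = actuator_gain L r M k * dst R M k i.
  rewrite (L2_dot_lebesgue_on _ _ (uE i) (phiE k))//.
  - exact: Rintegral_actuator_sin.
  - exact: measurable_indic_supp.
exists (fun i : 'I_M => \sum_(j < M) dst R M i j *: u j), phi; split.
- by rewrite -dst_span; exact: L2_spanE.
- exact: L2_spanE.
- move=> i k; rewrite L2_dot_suml.
  under eq_bigr => j _ do
    rewrite L2_dotZl L2_dotC (biorthogonal_dot _ _ uu) (mulrA (dst R M i j)).
  by rewrite -mulr_suml dst_orthogonal; case: ifP; rewrite ?mul0r // mulrC.
- move=> i k; rewrite L2_dot_suml.
  under eq_bigr => j _ do rewrite L2_dotZl uphi mulrCA.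
  by rewrite -mulr_sumr dst_orthogonal; case: eqP => [->|]; rewrite ?mulr0.
- move=> i k; rewrite (L2_dot_lebesgue_on _ _ (phiE i) (phiE k))//.
  exact: Rintegral_sin_sin.
Qed.

Lemma sin_div_lt (x y : R) : 0 < x -> x < y -> y <= pi -> sin y / y < sin x / x.
Proof.
move=> x0 xy ypi; have y0 := lt_trans x0 xy.
rewrite ltr_pdivrMr// mulrAC ltr_pdivlMr// mulrC [X in _ < X]mulrC.
exact: sin_mul_ltr.
Qed.

Lemma sin_div_le (x y : R) : 0 < x -> x <= y -> y <= pi -> sin y / y <= sin x / x.
Proof.
move=> x0; rewrite le_eqVlt => /predU1P[->//|xy] ypi.
exact/ltW/sin_div_lt.
Qed.

Lemma sin_div_gt0 (x : R) : 0 < x -> x < pi -> 0 < sin x / x.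
Proof. by move=> x0 xpi; rewrite divr_gt0// sin_gt0_pi// x0. Qed.

(** Isolates $\sin x/x$: the other factor is common to all modes, so gains compare through the
    monotonicity of $\sin x/x$. *)
Lemma actuator_gainE (M k : nat) (t : R) : t = r * pi / (2 * M%:R) -> 0 < t ->
  actuator_gain L r M k =
  2 * L * t / pi * (sin (k.+1%:R * t) / (k.+1%:R * t)).
Proof.
move=> tE t0; rewrite /actuator_gain -tE.
have pi0 : pi != 0 :> R by rewrite gt_eqF// pi_gt0.
have k0 : k.+1%:R != 0 :> R by rewrite pnatr_eq0.
move: (pi : R) (k.+1%:R : R) pi0 k0 {tE} => p a p0 a0; field.
by rewrite p0 a0 gt_eqF.
Qed.

Lemma actuator_gain_gt0 (M k : nat) : (k < M)%N -> 0 < actuator_gain L r M k.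
Proof.
move=> kM; have M0 : 0 < M%:R :> R by rewrite ltr0n (leq_trans _ kM).
have pi0 := pi_gt0 R.
rewrite /actuator_gain !mulr_gt0 ?invr_gt0 ?mulr_gt0//.
apply: sin_gt0_pi; rewrite !mulr_gt0 ?invr_gt0 ?mulr_gt0//=.
rewrite mulrA ltr_pdivrMr ?mulr_gt0//.
have kM' : k.+1%:R <= M%:R :> R by rewrite ler_nat.
have r_lt1 := r1.
rewrite mulrA [ltRHS]mulrC ltr_pM2r//.
apply: (@lt_le_trans _ _ k.+1%:R); first by rewrite gtr_pMr.
by lra.
Qed.

(* For the last row i + 1 = M, compare (M - 1) t with the half angle M t / 2,
   using sin (2 h) / (2 h) = cos h * (sin h / h) and 2 (cos h)^2 >= 1. *)
Lemma actuator_gain_min (M : nat) (i : 'I_M) : (2 <= M)%N ->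
  actuator_gain L r M M.-2 ^+ 2 * dst_weight R M M.-2 <=
  actuator_gain L r M i ^+ 2 * dst_weight R M i.
Proof.
move=> M2; have M0 : 0 < M%:R :> R by rewrite ltr0n (leq_trans _ M2).
have pi0 := pi_gt0 R; have r_lt1 := r1.
pose t := r * pi / (2 * M%:R); pose S (x : R) := sin x / x.
have t0 : 0 < t by rewrite divr_gt0 ?mulr_gt0.
have Mt : M%:R * t = r * pi / 2 by rewrite /t; field; rewrite gt_eqF.
have Mtpi : M%:R * t < pi / 2.
  by rewrite Mt ltr_pM2r// gtr_pMl.
have gE k : actuator_gain L r M k = 2 * L * t / pi * S (k.+1%:R * t).
  exact: actuator_gainE.
clearbody t; have : 0 < 2 * L * t / pi by rewrite divr_gt0// !mulr_gt0.
move: (2 * L * t / pi) gE => C gE C0.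
have ntpi (n : nat) : (n <= M)%N -> n%:R * t < pi.
  move=> nM; apply: (@le_lt_trans _ _ (M%:R * t)); last by lra.
  by rewrite ler_pM2r// ler_nat.
have Spos (n : nat) : (0 < n <= M)%N -> 0 < S (n%:R * t).
  move=> /andP[n0 nM]; apply: sin_div_gt0; last exact: ntpi.
  by rewrite mulr_gt0// ltr0n.
(* Rows being numbered from 0, [M.-2] is the mode $M-1$, whose weight is the ordinary $M/2$. *)
have Mpred : M.-2.+1 = M.-1 by lia.
rewrite !gE Mpred !(exprMn _ C) -!(mulrA (C ^+ 2)) ler_pM2l ?exprn_gt0//.
rewrite /dst_weight Mpred (_ : (M.-1 == M) = false); last by lia.
case: (eqVneq i.+1 M) => [iM|iM].
  rewrite iM; pose h := M%:R * t / 2.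
  have h0 : 0 < h by rewrite divr_gt0 ?mulr_gt0.
  have Mt0 : 0 < M%:R * t by rewrite mulr_gt0.
  (* Here $h=Mt/2\le(M-1)t$, because $M\ge2$. *)
  have Sh : S (M.-1%:R * t) <= S h.
    apply: sin_div_le => //; last by apply/ltW/ntpi; lia.
    rewrite /h mulrAC ler_pM2r// ler_pdivrMr// -natrM ler_nat; lia.
  have S2h : S (M%:R * t) = S h * cos h.
    rewrite /S (_ : M%:R * t = h *+ 2); last by rewrite /h mulr2n; field.
    by rewrite sin_mulr2n -mulr_natr; field; rewrite gt_eqF.
  (* $2\cos^2h=1+\cos(2h)$, and $2h=Mt<\pi/2$. *)
  have ch : 1 <= 2 * cos h ^+ 2.
    have : 0 <= cos (h *+ 2).
      apply: cos_ge0_pihalf; rewrite (_ : h *+ 2 = M%:R * t).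
        by apply/andP; split; lra.
      by rewrite /h mulr2n; field.
    rewrite cos_mulr2n; lra.
  have Sh2 : S (M.-1%:R * t) ^+ 2 <= S h ^+ 2.
    rewrite ler_pXn2r// ?nnegrE; first by apply/ltW/Spos; lia.
    by apply: le_trans Sh; apply/ltW/Spos; lia.
  rewrite S2h (exprMn _ (S h)); apply: (@le_trans _ _ (S h ^+ 2 * (M%:R / 2))).
    by rewrite ler_wpM2r.
  rewrite -[leRHS]mulrA ler_wpM2l ?sqr_ge0// ler_pdivrMr// mulrAC [_ * 2]mulrC.
  by rewrite ler_peMl// ltW.
(* The remaining rows share the weight $M/2$, so only the values of $\sin x/x$ are compared. *)
rewrite ler_pM2r ?divr_gt0//.
have iM' : (i.+1 < M)%N by rewrite ltn_neqAle iM ltn_ord.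
rewrite ler_pXn2r// ?nnegrE; [|by apply/ltW/Spos; lia..].
apply: sin_div_le; first by rewrite mulr_gt0.
- by rewrite ler_pM2r// ler_nat; lia.
- by apply/ltW/ntpi; lia.
Qed.

End oblique_projection_norm.

(** * Closed form of the norm *)

Section oblique_projection_limit.
Context (R : realType) (L r : R).
Context (L0 : 0 < L) (r0 : 0 < r) (r1 : r < 1).
Local Notation sine := (fun (i : nat) (x : R) => sin (i%:R * pi / L * x)).
Local Notation P M :=
  (oblique_proj (actuator_span L r M) (orthocomp (eigen_span L sine M))).

Lemma actuator_direct_sum (M : nat) :
  is_direct_sum (actuator_span L r M) (orthocomp (eigen_span L sine M)).
Proof.
have [v [phi [UE EE vv vphi phiphi]]] := actuator_biorthogonal L0 r0 r1 M.
apply: (biorthogonal_direct_sum UE EE vv vphi) => i.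
  have M0 : 0 < M%:R :> R by rewrite ltr0n (leq_trans _ (ltn_ord i)).
  by rewrite mulr_gt0 ?dst_weight_gt0// divr_gt0// mulr_gt0.
by rewrite gt_eqF// mulr_gt0 ?dst_weight_gt0 ?actuator_gain_gt0.
Qed.

(** Up to the constant $r\pi/2$, this is $\sin x/x$ at $x=ar\pi/2$. At $a=1-1/M$ it carries the
    whole dependence of the norm on $M$; $a=1$ gives the limit. *)
Definition oblique_factor (a : R) : R := sin (a * (r * pi / 2)) / a.

Lemma oblique_factor_gt0 a : 0 < a -> a <= 1 -> 0 < oblique_factor a.
Proof.
move=> a0 a1; have pi0 := pi_gt0 R; have r_lt1 := r1.
have t0 : 0 < r * pi / 2 by rewrite divr_gt0 ?mulr_gt0.
rewrite divr_gt0// sin_gt0_pi// mulr_gt0//=.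
apply: (@le_lt_trans _ _ (r * pi / 2)); first by rewrite ler_piMl// ltW.
by rewrite ltr_pdivrMr// [ltRHS]mulrC ltr_pM2r//; lra.
Qed.

Lemma oblique_factor_lt a b : 0 < a -> a < b -> b <= 1 ->
  oblique_factor b < oblique_factor a.
Proof.
move=> a0 ab b1; have pi0 := pi_gt0 R; have r_lt1 := r1.
have b0 := lt_trans a0 ab.
have t0 : 0 < r * pi / 2 by rewrite divr_gt0 ?mulr_gt0.
have tpi : r * pi / 2 < pi.
  by rewrite ltr_pdivrMr// [ltRHS]mulrC ltr_pM2r//; lra.
rewrite /oblique_factor; move: (r * pi / 2) t0 tpi => t t0 tpi.
have := @sin_div_lt R (a * t) (b * t); rewrite ltr_pM2r// => /(_ _ ab).
rewrite mulr_gt0// => /(_ isT).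
rewrite !invfM !mulrA ltr_pM2r ?invr_gt0//; apply.
by apply: le_trans (ltW tpi); rewrite ler_piMl// ltW.
Qed.

Lemma oblique_op_norm (M : nat) : (2 <= M)%N ->
  op_norm (P M) =
  (Num.sqrt r * pi / (2 * oblique_factor (1 - M%:R^-1)))%:E.
Proof.
move=> M2; have [v [phi [UE EE vv vphi phiphi]]] := actuator_biorthogonal L0 r0 r1 M.
have M0 : 0 < M%:R :> R by rewrite ltr0n (leq_trans _ M2).
have M1 : 0 < M%:R - 1 :> R by rewrite subr_gt0 ltr1n.
have pi0 := pi_gt0 R.
have mM : (M.-2 < M)%N by lia.
have p0 (i : 'I_M) : 0 < r * L / M%:R * dst_weight R M i.
  by rewrite mulr_gt0 ?dst_weight_gt0// divr_gt0// mulr_gt0.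
have q0 (i : 'I_M) : actuator_gain L r M i * dst_weight R M i != 0.
  by rewrite gt_eqF// mulr_gt0 ?dst_weight_gt0 ?actuator_gain_gt0.
(* One weight cancels, so the largest ratio is where the quantity of [actuator_gain_min] is
   least. *)
have pq (i : 'I_M) : r * L / M%:R * dst_weight R M i /
    (actuator_gain L r M i * dst_weight R M i) ^+ 2 =
    r * L / M%:R / (actuator_gain L r M i ^+ 2 * dst_weight R M i).
  have g0 := actuator_gain_gt0 L0 r0 r1 (ltn_ord i).
  have w0 := dst_weight_gt0 R (ltn_ord i).
  by field; rewrite !gt_eqF.
have den0 (i : 'I_M) : 0 < actuator_gain L r M i ^+ 2 * dst_weight R M i.
  by rewrite mulr_gt0 ?exprn_gt0 ?dst_weight_gt0 ?actuator_gain_gt0.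
have c0 : 0 < L / 2 by rewrite divr_gt0.
have max (i : 'I_M) :
    r * L / M%:R * dst_weight R M i /
      (actuator_gain L r M i * dst_weight R M i) ^+ 2 <=
    r * L / M%:R * dst_weight R M (Ordinal mM) /
      (actuator_gain L r M (Ordinal mM) * dst_weight R M (Ordinal mM)) ^+ 2.
  rewrite !pq ler_pM2l; last by rewrite divr_gt0// mulr_gt0.
  by rewrite lef_pV2 ?posrE//; exact: (actuator_gain_min L0 r0 r1).
rewrite (biorthogonal_op_norm UE EE vv vphi phiphi p0 q0 c0 max).
congr EFin; rewrite pq /=.
have Mpred : M.-2.+1%:R = M%:R - 1 :> R.
  by rewrite -subn2 subnSK// natrB// ltnW.
have s0 := oblique_factor_gt0.
have a0 : 0 < 1 - M%:R^-1 :> R by rewrite subr_gt0 invf_lt1// ltr1n.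
have a1 : 1 - M%:R^-1 <= 1 :> R by rewrite gerBl invr_ge0 ltW.
have := s0 _ a0 a1.
have -> : actuator_gain L r M M.-2 =
    2 * L / (M%:R * pi) * oblique_factor (1 - M%:R^-1).
  rewrite /actuator_gain /oblique_factor Mpred.
  rewrite (_ : (M%:R - 1) * (r * pi / (2 * M%:R)) =
    (1 - M%:R^-1) * (r * pi / 2)); last by field; rewrite gt_eqF.
  rewrite (_ : 1 - M%:R^-1 = (M%:R - 1) / M%:R); last by field; rewrite gt_eqF.
  move: (sin _) => s; move: (pi : R) pi0 => p pi0; field.
  by rewrite !gt_eqF.
rewrite /dst_weight ifF; last by lia.
move: (oblique_factor _) => s s_gt0.
(* All powers of $L$ and $M$ cancel; $M$ remains only inside [s]. *)
have -> : L / 2 * (r * L / M%:R /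
    ((2 * L / (M%:R * pi) * s) ^+ 2 * (M%:R / 2))) =
    r * (pi / (2 * s)) ^+ 2.
  by move: (pi : R) pi0 => p pi0; field; rewrite !gt_eqF.
rewrite sqrtrM ?ltW// sqrtr_sqr ger0_norm ?mulrA//.
by rewrite ltW// divr_gt0// mulr_gt0.
Qed.

End oblique_projection_limit.

(** Only the span of the eigenfunctions enters, so the given eigensystem is exchanged for the sines;
    the claims on the norm are then read off its expression by [oblique_factor]. *)
Theorem theorem2p1 (R : realType) (L r : R) (lam : nat -> R)
    (e : nat -> R -> R) :
  0 < L -> 0 < r < 1 -> dirichlet_eigensystem L lam e ->
  let U M := actuator_span L r M in
  let E M := eigen_span L e M in
  let P M := oblique_proj (U M) (orthocomp (E M)) in
  [/\ forall M : nat, (1 <= M)%N -> is_direct_sum (U M) (orthocomp (E M)),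
      forall M : nat, (2 <= M)%N ->
        op_norm (P M) =
          ((4 * M%:R ^+ 2 / (r * pi ^+ 2 * (M%:R - 1) ^+ 2) *
            sin ((M%:R - 1) * r * pi / (2 * M%:R)) ^+ 2) `^ (- 2^-1))%:E,
      forall M N : nat, (2 <= M)%N -> (M < N)%N ->
        (op_norm (P M) < op_norm (P N))%E &
      op_norm (P M) @[M --> \oo] -->
        (Num.sqrt r * pi / (2 * sin (r * pi / 2)))%:E].
Proof.
move=> L0 /andP[r0 r1] es U E P.
have pi0 := pi_gt0 R.
have EE M : E M = eigen_span L (fun i x => sin (i%:R * pi / L * x)) M.
  exact: eigen_span_sinE es.
have a0 (M : nat) : (2 <= M)%N -> 0 < 1 - M%:R^-1 :> R.
  by move=> M2; rewrite subr_gt0 invf_lt1 ?ltr1n// ltr0n; lia.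
have a1 (M : nat) : 1 - M%:R^-1 <= 1 :> R by rewrite gerBl invr_ge0.
have PE M : (2 <= M)%N -> op_norm (P M) =
    (Num.sqrt r * pi / (2 * oblique_factor r (1 - M%:R^-1)))%:E.
  by move=> M2; rewrite /P EE; exact: oblique_op_norm.
have sr0 : 0 < Num.sqrt r by rewrite sqrtr_gt0.
split.
- by move=> M _; rewrite EE; exact: actuator_direct_sum.
- move=> M M2; rewrite PE//; congr EFin.
  have s0 := oblique_factor_gt0 r0 r1 (a0 _ M2) (a1 M).
  have M0 : 0 < M%:R :> R by rewrite ltr0n; lia.
  have M1 : 0 < M%:R - 1 :> R by rewrite subr_gt0 ltr1n.
  (* The base is the squared inverse of the expression in [PE], which the power $-1/2$ therefore
     returns. *)
  have -> : 4 * M%:R ^+ 2 / (r * pi ^+ 2 * (M%:R - 1) ^+ 2) *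
      sin ((M%:R - 1) * r * pi / (2 * M%:R)) ^+ 2 =
      (2 * oblique_factor r (1 - M%:R^-1) / (Num.sqrt r * pi)) ^+ 2.
    rewrite /oblique_factor.
    rewrite (_ : (M%:R - 1) * r * pi / (2 * M%:R) =
      (1 - M%:R^-1) * (r * pi / 2)); last by field; rewrite gt_eqF.
    rewrite (_ : 1 - M%:R^-1 = (M%:R - 1) / M%:R); last by field; rewrite gt_eqF.
    move: (sin _) (sqr_sqrtr (ltW r0)) => s; move: (Num.sqrt r) sr0 => q q0 <-.
    move: (pi : R) pi0 => p p0; field.
    by rewrite !gt_eqF.
  rewrite powRN powR12_sqrt ?sqr_ge0// sqrtr_sqr ger0_norm ?invf_div//.
  by rewrite ltW// divr_gt0// mulr_gt0.
- move=> M N M2 MN; have N2 : (2 <= N)%N by lia.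
  (* $1-1/M$ grows with $M$, the factor decreases, and the norm is proportional to its inverse. *)
  rewrite !PE// lte_fin ltr_pM2l ?mulr_gt0//.
  have s0 K : (2 <= K)%N -> 0 < 2 * oblique_factor r (1 - K%:R^-1).
    by move=> K2; rewrite mulr_gt0// oblique_factor_gt0 ?a0.
  rewrite ltf_pV2 ?posrE ?s0//.
  rewrite ltr_pM2l//; apply: oblique_factor_lt; rewrite ?a0//.
  rewrite ltrD2l ltrN2 ltf_pV2 ?posrE ?ltr0n ?ltr_nat//; lia.
- have t0 : 0 < r * pi / 2 by rewrite divr_gt0 ?mulr_gt0.
  have st0 : 0 < sin (r * pi / 2).
    have := oblique_factor_gt0 r0 r1 (@ltr01 R) (lexx 1).
    by rewrite /oblique_factor mul1r divr1.
  have acvg : (1 - M%:R^-1 : R) @[M --> \oo] --> (1 : R).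
    rewrite -[X in _ --> X]subr0; apply: cvgB; first exact: cvg_cst.
    by rewrite -cvg_shiftS; exact: cvg_harmonic.
  have lim : (Num.sqrt r * pi / (2 * oblique_factor r (1 - M%:R^-1)))
      @[M --> \oo] --> Num.sqrt r * pi / (2 * sin (r * pi / 2)).
    apply: cvgM; first exact: cvg_cst.
    apply: cvgV; first by rewrite mulf_neq0// gt_eqF.
    apply: cvgM; first exact: cvg_cst.
    rewrite -[X in _ --> X]divr1; apply: cvgM; last exact: cvgV.
    rewrite -[X in _ --> sin X]mul1r.
    apply: continuous_cvg; first exact: continuous_sin.
    by apply: cvgM => //; exact: cvg_cst.
  (* Convergence of extended reals reduces to eventual finiteness and convergence of the real
     values; [PE] provides both from $M=2$ on. *)
  apply/fine_cvgP; split.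
    by near=> M; rewrite PE//; near: M; exact: nbhs_infty_ge.
  apply: cvg_trans lim; apply: near_eq_cvg; near=> M; rewrite /= PE//.
  by near: M; exact: nbhs_infty_ge.
Unshelve. all: by end_near.
Qed.
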